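(* Let $X$ be a reflexive real Banach space and let $A\subset\mathcal{B}(X)$ be a commutative algebra all of whose elements are essentially real operators. Then $A$ has an invariant subspace: there is a closed subspace $L$ of $X$ with $\{0\}\ne L\ne X$ and $TL\subset L$ for all $T\in A$.
   Context: $\mathcal{B}(X)$ is the algebra of all bounded linear operators on $X$, $\mathcal{K}(X)$ is the ideal of compact operators, and $\|T\|_e=\inf\{\|T+K\|:K\in\mathcal{K}(X)\}$ is the essential norm. An operator $T\in\mathcal{B}(X)$ is essentially real if $\|1-\varepsilon T^2\|_e\le 1+o(\varepsilon)$ as $\varepsilon\searrow 0$, where $1$ is the identity operator. Algebras are real subalgebras of $\mathcal{B}(X)$, not assumed closed or unital. ''Invariant subspace'' means closed, non-trivial (different from $\{0\}$ and the whole space) invariant subspace.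
   Formalization: X is assumed to have dimension at least 3: as worded the claim fails in dimensions 0 and 1, where there is no non-trivial subspace, and in dimension 2, where the algebra generated by a rotation by 90 degrees has no invariant line although all its elements are compact, hence essentially real. *)

(* Defs.v *)
From mathcomp Require Import all_boot all_order all_algebra.
From mathcomp Require Import all_classical all_reals all_analysis.
Import Order.TTheory GRing.Theory Num.Theory numFieldNormedType.Exports.

Set Implicit Arguments.
Unset Strict Implicit.
Unset Printing Implicit Defensive.

Local Open Scope classical_set_scope.
Local Open Scope ring_scope.

Section Operators.
Context {R : realType}.

(* For a linear map, boundedness near 0 is equivalent to the existence of M
   with |f x| <= M |x| for all x (linear_boundedP). *)
Definition bounded_linear (V W : normedModType R) : set (V -> W) :=
  [set f | linear f /\ bounded_near f (nbhs (0 : V))].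

(* [sup] is meaningful here only when f is bounded on the unit ball. *)
Definition opnorm (V W : normedModType R) (f : V -> W) : R :=
  sup [set `|f x| | x in [set x : V | `|x| <= 1]].

Definition dual (X : normedModType R) : set (X -> R^o) :=
  @bounded_linear X R^o.

(* A functional on the dual of X is represented by a function on all of
   X -> R^o whose values outside of the dual are irrelevant. *)
Definition bidual (X : normedModType R) : set ((X -> R^o) -> R) :=
  [set phi |
    (forall (a : R) (f g : X -> R^o), dual f -> dual g ->
       phi (a *: f + g) = a * phi f + phi g) /\
    (exists M : R, forall f : X -> R^o, dual f -> `|phi f| <= M * opnorm f)].

Definition reflexive_space (X : normedModType R) : Prop :=
  forall phi, bidual phi ->
    exists x : X, forall f : X -> R^o, dual f -> phi f = f x.

Definition dim_at_least (n : nat) (X : lmodType R) : Prop :=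
  exists e : 'I_n -> X, forall c : 'I_n -> R,
    \sum_(i < n) c i *: e i = 0 -> forall i, c i = 0.

Variable X : normedModType R.

Definition operators : set (X -> X) := @bounded_linear X X.

Definition compact_operators : set (X -> X) :=
  [set K | operators K /\ precompact (K @` [set x : X | `|x| <= 1])].

Definition essential_norm (T : X -> X) : R :=
  inf [set opnorm (T + K) | K in compact_operators].

Definition essentially_real (T : X -> X) : Prop :=
  operators T /\
  exists2 h : R -> R^o, h =o_ (0^'+) (fun eps : R => eps : R^o) &
    \forall eps \near 0^'+,
      essential_norm (idfun - eps *: (T \o T)) <= 1 + h eps.

Definition operator_algebra (A : set (X -> X)) : Prop :=
  [/\ A `<=` operators,
      A 0,
      forall S T, A S -> A T -> A (S + T),
      forall (a : R) T, A T -> A (a *: T) &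
      forall S T, A S -> A T -> A (S \o T)].

Definition commutative_family (A : set (X -> X)) : Prop :=
  forall S T, A S -> A T -> S \o T = T \o S.

Definition linear_subspace (L : set X) : Prop :=
  L 0 /\ forall (a : R) (x y : X), L x -> L y -> L (a *: x + y).

Definition invariant_subspace (A : set (X -> X)) (L : set X) : Prop :=
  [/\ linear_subspace L, closed L, L <> [set 0], L <> setT &
      forall T, A T -> T @` L `<=` L].

End Operators.

(* Main.v *)
(* Suppose that A has no invariant subspace, and let B = R 1 + A.  Let G be the
   set of T in B that map the unit ball into a finite union of balls of radius 1:
   a convex multiplicative semigroup, which for S in A contains
   (1 - e S^2) / (1 + d e) for every d > 0 and some e > 0.

   If G x is dense for all x <> 0, so is eta G x for eta > 0, and weak
   compactness of a ball D not containing 0 yields finitely many T_i in G / 4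
   such that each point of D is returned to D by some T_i.  Iterating, we get
   words W_n of length n in the T_i with W_n x_0 in D.  The image of the unit
   ball under W_n is covered by M^n balls of radius 4^-n, so among the
   combinations of d elements of B with coefficients in {0, ..., 2^n}, where
   M <= 2^d, two become nearly equal at W_n x_0.  Normalizing the difference and
   passing to a weak limit gives a combination of these d elements with
   nontrivial kernel, which is 0 by commutativity.  Hence dim B < d, and B is a
   field of dimension at most 2 over R, which is impossible since dim X >= 3.

   Otherwise the closed convex set C = closure (G x) is proper for some x <> 0.
   By reflexivity it has a support point z <> 0, with functional f; comparing
   f z with f ((1 - e S^2) z) gives f (S^2 z) >= 0 for all S in A.  The vectors z
   with this property form a closed convex proper cone P which is mapped into
   itself by S^2 and, if |S| <= 1, by 1 - S^2.  At a support point z <> 0 of P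
   with functional g we have g z = 0, so g (S^2 z) = 0 for all S in A, and by
   polarization g vanishes on a dense set. *)
From HB Require Import structures.
Require Import Defs.
From mathcomp Require Import all_boot all_order all_algebra.
From mathcomp Require Import all_classical all_reals all_analysis.
From mathcomp Require Import ring lra complex.
Import Order.TTheory GRing.Theory Num.Theory numFieldNormedType.Exports.
Set Implicit Arguments.
Unset Strict Implicit.
Unset Printing Implicit Defensive.
Local Open Scope classical_set_scope.
Local Open Scope ring_scope.

(** * Sublinear functionals and the Hahn-Banach theorem *)

Section HahnBanach.
Context {R : realType} {V : lmodType R}.
Implicit Types (m s : V -> R) (v x y : V).

Definition sublinear m : Prop :=
  (forall t x, 0 <= t -> m (t *: x) = t * m x) /\
  (forall x y, m (x + y) <= m x + m y).

Lemma sublinear0 m : sublinear m -> m 0 = 0.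
Proof. by move=> [mZ _]; rewrite -(scale0r 0) mZ// mul0r. Qed.

Lemma sublinear_ge m x : sublinear m -> - m (- x) <= m x.
Proof.
move=> sm; rewrite -subr_ge0 opprK -(sublinear0 sm) -(subrr x).
exact: sm.2.
Qed.

(** Scaling gives [t * inf (E x) <= inf (E (t *: x))] for [0 < t]; the converse is the same
    inequality for [t^-1]. *)
Lemma inf_homogeneous (E : V -> set R) :
    (forall t x r, 0 < t -> E x r -> E (t *: x) (t * r)) ->
    (forall x, has_inf (E x)) -> inf (E 0) = 0 ->
  forall t x, 0 <= t -> inf (E (t *: x)) = t * inf (E x).
Proof.
move=> EZ Einf E0 t x; rewrite le0r => /orP[/eqP ->|t0].
  by rewrite scale0r mul0r.
have ge u y : 0 < u -> u * inf (E y) <= inf (E (u *: y)).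
  move=> u0; apply: lb_le_inf; first exact: (Einf _).1.
  move=> r Er; rewrite -ler_pdivlMl//; apply: ge_inf; first exact: (Einf _).2.
  rewrite -[X in E X](scalerK (lt0r_neq0 u0)).
  by apply: EZ => //; rewrite invr_gt0.
apply/eqP; rewrite eq_le ge// andbT.
have ti0 : 0 < t^-1 by rewrite invr_gt0.
by have := ge _ (t *: x) ti0; rewrite scalerK ?gt_eqF// ler_pdivrMl.
Qed.

Lemma inf_subadditive (E : V -> set R) :
    (forall x, has_inf (E x)) ->
    (forall x y (a b : R), E x a -> E y b -> exists2 u, E (x + y) u & u <= a + b) ->
  forall x y, inf (E (x + y)) <= inf (E x) + inf (E y).
Proof.
move=> Einf ED x y; apply/ler_addgt0Pr => e e0.
have e2 : 0 < e / 2 by lra.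
have [r Er rx] := inf_adherent e2 (Einf x).
have [b Eb yb] := inf_adherent e2 (Einf y).
have [u Eu us] := ED _ _ _ _ Er Eb.
have := ge_inf (Einf (x + y)).2 Eu; lra.
Qed.

(** Zorn's lemma for the reversed pointwise order. A chain is bounded by its pointwise infimum,
    which is finite because each member is at least [- q (- x)] at [x], and subadditive because any
    two members are comparable. *)
Lemma minimal_sublinear q : sublinear q ->
  exists m, [/\ sublinear m, forall x, m x <= q x &
    forall s, sublinear s -> (forall x, s x <= m x) -> s = m].
Proof.
move=> subq.
pose T := {m : V -> R | sublinear m /\ forall x, m x <= q x}.
pose Rl (a b : T) : bool := `[< forall x, sval b x <= sval a x >].
have [| | | |m mmax] := @Zorn T Rl.
- by move=> t; apply/asboolP => x.
- move=> r s t /asboolP rs /asboolP st; apply/asboolP => x.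
  exact: le_trans (st x) (rs x).
- move=> [s ps] [t pt] /asboolP /= st /asboolP /= ts.
  have e : s = t by apply/funext => x; apply/eqP; rewrite eq_le st ts.
  by subst t; congr exist; exact: Prop_irrelevance.
- move=> A Atot; have [[a Aa]|A0] := pselect (A !=set0); last first.
    exists (exist _ q (conj subq (fun x => lexx (q x)))) => s As.
    by exfalso; apply: A0; exists s.
  pose E x := [set sval b x | b in A].
  have Einf x : has_inf (E x).
    split; first by exists (sval a x), a.
    exists (- q (- x)) => _ [b Ab <-].
    apply: le_trans (sublinear_ge _ (svalP b).1).
    by rewrite lerN2; exact: (svalP b).2.
  have subE : sublinear (fun x => inf (E x)).
    split.
      apply: inf_homogeneous => //.
        by move=> t x _ t0 [b Ab <-]; exists b => //; rewrite (svalP b).1.1// ltW.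
      suff -> : E 0 = [set 0] by rewrite inf1.
      apply/seteqP; split=> [_ [b Ab <-]|_ ->] /=.
        by rewrite sublinear0//; exact: (svalP b).1.
      by exists a => //; rewrite sublinear0//; exact: (svalP a).1.
    apply: inf_subadditive => // x y _ _ [b Ab <-] [c Ac <-].
    have [/asboolP bc|/asboolP cb] := Atot _ _ Ab Ac.
      exists (sval c (x + y)); first by exists c.
      by apply: le_trans ((svalP c).1.2 _ _) _; rewrite lerD2r.
    exists (sval b (x + y)); first by exists b.
    by apply: le_trans ((svalP b).1.2 _ _) _; rewrite lerD2l.
  have leE x : inf (E x) <= q x.
    apply: le_trans ((svalP a).2 x).
    by apply: ge_inf; [exact: (Einf x).2|exists a].
  pose b : T := exist _ (fun x => inf (E x)) (conj subE leE).
  exists b => s As; apply/asboolP => x /=.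
  by apply: ge_inf; [exact: (Einf x).2|exists s].
exists (sval m); split; [exact: (svalP m).1|exact: (svalP m).2|].
move=> s subs sm.
have sq x : s x <= q x := le_trans (sm x) ((svalP m).2 x).
have /mmax <- // : Rl m (exist _ s (conj subs sq)) by apply/asboolP.
Qed.

(* A minimal sublinear functional m is additive: for each v, the sublinear
   functional x |-> inf_(t >= 0) (m (x + t v) - t m v) lies below m. *)
Lemma sublinear_dominates q : sublinear q ->
  exists f : V -> R^o, linear f /\ forall x, f x <= q x.
Proof.
move=> subq; have [m [subm mq mmin]] := minimal_sublinear subq.
have mD x v : m (x + v) = m x + m v.
  apply/eqP; rewrite eq_le subm.2/=.
  pose E y := [set m (y + t *: v) - t * m v | t in [set t | 0 <= t]].
  have Einf y : has_inf (E y).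
    split; first by exists (m (y + 0 *: v) - 0 * m v), 0 => //=.
    exists (- m (- y)) => _ [t /= t0 <-].
    have := subm.2 (y + t *: v) (- y).
    by rewrite addrC addKr subm.1//; lra.
  have subE : sublinear (fun y => inf (E y)).
    split.
      apply: inf_homogeneous => //.
        move=> t y _ t0 [u /= u0 <-]; exists (t * u) => /=.
          by rewrite mulr_ge0// ltW.
        by rewrite -scalerA -scalerDr subm.1 ?(ltW t0)//; ring.
      suff -> : E 0 = [set 0] by rewrite inf1.
      apply/seteqP; split=> [_ [u /= u0 <-]|_ ->] /=.
        by rewrite add0r subm.1// subrr.
      by exists 0 => //=; rewrite scale0r addr0 sublinear0// mul0r subr0.
    apply: inf_subadditive => // y z _ _ [t /= t0 <-] [u /= u0 <-].
    exists (m (y + z + (t + u) *: v) - (t + u) * m v).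
      by exists (t + u) => //=; rewrite addr_ge0.
    have := subm.2 (y + t *: v) (z + u *: v).
    by rewrite scalerDl addrACA; lra.
  have leE y : inf (E y) <= m y.
    apply: ge_inf; first exact: (Einf y).2.
    by exists 0 => //=; rewrite scale0r addr0 mul0r subr0.
  have := mmin _ subE leE => /(congr1 (fun h => h x)) /= <-.
  rewrite -lerBrDr; apply: ge_inf; first exact: (Einf x).2.
  by exists 1; rewrite /= ?scale1r ?mul1r.
have mN x : m (- x) = - m x.
  by apply/eqP; rewrite -addr_eq0 -mD addNr sublinear0.
exists m; split=> // a x y; rewrite mD; congr (_ + _).
have [a0|a0] := leP 0 a; first by rewrite subm.1.
by rewrite -[a *: x]opprK mN -scaleNr subm.1 ?oppr_ge0 ?(ltW a0)// mulNr opprK.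
Qed.

End HahnBanach.

(** * Bounded linear maps and closures in norm *)

Section NormedSpace.
Context {R : realType}.
Implicit Types X Y Z : normedModType R.

Lemma linear_mixed {V W : lmodType R} (f : V -> W) : linear f ->
  exists F : {linear V -> W}, f = F.
Proof.
move=> lf; pose F : {linear V -> W} := HB.pack f (GRing.isLinear.Build _ _ _ _ f lf).
by exists F.
Qed.

Lemma bounded_linearP X Y (f : X -> Y) : bounded_linear f <->
  linear f /\ exists2 M, 0 <= M & forall x, `|f x| <= M * `|x|.
Proof.
split=> -[lf bf]; split=> //; have [F fE] := linear_mixed lf; subst f.
  have /linear_boundedP/pinfty_ex_gt0 [M M0 Mb] := bf.
  by exists M => //; exact: ltW.
have [M M0 Mb] := bf; apply/linear_boundedP; exists M; split.
  exact: ger0_real.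
by move=> r /ltW Mr x; apply: le_trans (Mb x) _; rewrite ler_wpM2r.
Qed.

Section BoundedLinear.
Context {X Y : normedModType R} (f : X -> Y) (bf : bounded_linear f).
Implicit Types x y : X.

Let F := projT1 (cid (linear_mixed bf.1)).
Let fE : f = F := projT2 (cid (linear_mixed bf.1)).

Lemma bl0 : f 0 = 0. Proof. by rewrite fE raddf0. Qed.
Lemma blD x y : f (x + y) = f x + f y. Proof. by rewrite fE raddfD. Qed.
Lemma blN x : f (- x) = - f x. Proof. by rewrite fE raddfN. Qed.
Lemma blB x y : f (x - y) = f x - f y. Proof. by rewrite fE raddfB. Qed.
Lemma blZ (a : R) x : f (a *: x) = a *: f x. Proof. by rewrite fE linearZ. Qed.
Lemma bl_sum (I : Type) (r : seq I) (P : pred I) (v : I -> X) :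
  f (\sum_(i <- r | P i) v i) = \sum_(i <- r | P i) f (v i).
Proof. by rewrite fE raddf_sum. Qed.

Lemma bl_bound : exists2 M, 0 <= M & forall x, `|f x| <= M * `|x|.
Proof. by have [] := (bounded_linearP f).1 bf. Qed.

Lemma bl_bound_gt0 : exists2 M, 0 < M & forall x, `|f x| <= M * `|x|.
Proof.
have [M M0 Mb] := bl_bound; exists (M + 1) => [|x]; first lra.
by apply: le_trans (Mb x) _; rewrite ler_wpM2r//; lra.
Qed.

End BoundedLinear.

Lemma le_opnorm_ball X Y (f : X -> Y) x :
  bounded_linear f -> `|x| <= 1 -> `|f x| <= opnorm f.
Proof.
move=> bf x1; have [M M0 Mb] := bl_bound bf; apply: ub_le_sup; last by exists x.
exists M => _ [y /= y1 <-]; apply: le_trans (Mb y) _.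
by rewrite -[leRHS]mulr1 ler_wpM2l.
Qed.

Lemma opnorm_ge0 X Y (f : X -> Y) : bounded_linear f -> 0 <= opnorm f.
Proof.
move=> bf; have := @le_opnorm_ball _ _ f 0 bf.
by rewrite (bl0 bf) !normr0; apply.
Qed.

Lemma le_opnorm X Y (f : X -> Y) x :
  bounded_linear f -> `|f x| <= opnorm f * `|x|.
Proof.
move=> bf; have [->|x0] := eqVneq x 0; first by rewrite (bl0 bf) !normr0 mulr0.
have nx : 0 < `|x| by rewrite normr_gt0.
rewrite -ler_pdivrMr//; have := @le_opnorm_ball _ _ f (`|x|^-1 *: x) bf.
rewrite (blZ bf) !normrZ normfV normr_id mulVf ?gt_eqF// mulrC; exact.
Qed.

Lemma bounded_linear_id X : bounded_linear (@idfun X).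
Proof.
apply/bounded_linearP; split; first by move=> a x y.
by exists 1 => // x; rewrite mul1r.
Qed.

Lemma bounded_linear_comp X Y Z (f : Y -> Z) (g : X -> Y) :
  bounded_linear f -> bounded_linear g -> bounded_linear (f \o g).
Proof.
move=> bf bg; apply/bounded_linearP; split.
  by move=> a x y /=; rewrite (blD bg) (blZ bg) (blD bf) (blZ bf).
have [M M0 Mb] := bl_bound bf; have [N N0 Nb] := bl_bound bg.
exists (M * N); rewrite ?mulr_ge0// => x /=; apply: le_trans (Mb _) _.
by rewrite -mulrA ler_wpM2l.
Qed.

Lemma fctDE (T : Type) (V : zmodType) (f g : T -> V) x : (f + g) x = f x + g x.
Proof. by []. Qed.

Lemma fctZE (T : Type) (V : lmodType R) (a : R) (f : T -> V) x :
  (a *: f) x = a *: f x.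
Proof. by []. Qed.

Lemma bounded_linearD X Y (f g : X -> Y) :
  bounded_linear f -> bounded_linear g -> bounded_linear (f + g).
Proof.
move=> bf bg; apply/bounded_linearP; split.
  move=> a x y; rewrite !fctDE (blD bg) (blZ bg) (blD bf) (blZ bf).
  by rewrite scalerDr addrACA.
have [M M0 Mb] := bl_bound bf; have [N N0 Nb] := bl_bound bg.
exists (M + N); rewrite ?addr_ge0// => x; rewrite fctDE; apply: le_trans (ler_normD _ _) _.
by rewrite mulrDl lerD.
Qed.

Lemma bounded_linearZ X Y (a : R) (f : X -> Y) :
  bounded_linear f -> bounded_linear (a *: f).
Proof.
move=> bf; apply/bounded_linearP; split.
  by move=> b x y; rewrite !fctZE (blD bf) (blZ bf) scalerDr !scalerA mulrC.
have [M M0 Mb] := bl_bound bf.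
exists (`|a| * M); rewrite ?mulr_ge0// => x.
by rewrite fctZE normrZ -mulrA ler_wpM2l.
Qed.

Lemma bounded_linear_cst0 X Y : bounded_linear (0 : X -> Y).
Proof.
apply/bounded_linearP; split; first by move=> a x y /=; rewrite scaler0 addr0.
by exists 0 => // x; rewrite normr0 mul0r.
Qed.

Lemma closure_normP X (C : set X) x :
  closure C x <-> forall e : R, 0 < e -> exists2 c, C c & `|x - c| <= e.
Proof.
split=> [Cx e e0|Cx B /nbhs_normP[e/= e0 eB]].
  have [c [Cc xc]] := Cx _ (nbhsx_ballx x e e0).
  by exists c => //; move: xc; rewrite -ball_normE => /ltW.
have e2 : 0 < e / 2 by rewrite divr_gt0.
have [c Cc xc] := Cx _ e2; exists c; split=> //; apply: eB => /=.
by apply: le_lt_trans xc _; rewrite ltr_pdivrMr// ltr_pMr// ltr1n.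
Qed.

Lemma closure_stable X (T : X -> X) (C : set X) : bounded_linear T ->
  T @` C `<=` C -> T @` closure C `<=` closure C.
Proof.
move=> bT TC _ [x /closure_normP Cx <-]; apply/closure_normP => e e0.
have [M M0 MT] := bl_bound_gt0 bT; have [c Cc xc] := Cx (e / M) (divr_gt0 e0 M0).
exists (T c); first by apply: TC; exists c.
by rewrite -(blB bT); apply: le_trans (MT _) _; rewrite mulrC -ler_pdivlMr.
Qed.

(** The scalars are fixed in advance, so that one statement serves subspaces and convex sets
    alike. *)
Lemma closure_combination X (C : set X) (s t : R) x y :
    (forall x y, C x -> C y -> C (s *: x + t *: y)) ->
  closure C x -> closure C y -> closure C (s *: x + t *: y).
Proof.
move=> Cst /closure_normP Cx /closure_normP Cy; apply/closure_normP => e e0.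
pose K := `|s| + `|t| + 1; have K0 : 0 < K by rewrite ltr_wpDl// addr_ge0.
have eK : 0 < e / K by rewrite divr_gt0.
have [c Cc xc] := Cx _ eK; have [d Cd yd] := Cy _ eK.
exists (s *: c + t *: d); first exact: Cst.
rewrite opprD addrACA -!scalerBr; apply: le_trans (ler_normD _ _) _.
rewrite !normrZ; have h1 : `|s| * `|x - c| <= `|s| * (e / K) by rewrite ler_wpM2l.
have h2 : `|t| * `|y - d| <= `|t| * (e / K) by rewrite ler_wpM2l.
have h3 : `|s| * (e / K) + `|t| * (e / K) + e / K = e.
  by rewrite -[X in _ + X = _]mul1r -!mulrDl -/K mulrC divfK// gt_eqF.
lra.
Qed.

Lemma closed_ker X Y (f : X -> Y) : bounded_linear f -> closed [set x | f x = 0].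
Proof.
move=> bf; apply/closure_id; apply/seteqP; split; first exact: subset_closure.
move=> x /closure_normP fx /=; apply/eqP; rewrite -normr_le0.
have [M M0 Mf] := bl_bound_gt0 bf; apply/ler_addgt0Pr => e e0; rewrite add0r.
have [y fy xy] := fx (e / M) (divr_gt0 e0 M0).
rewrite -(subrK y x) (blD bf) fy addr0; apply: le_trans (Mf _) _.
by rewrite mulrC -ler_pdivlMr.
Qed.

End NormedSpace.

(** * Separation of convex sets and weak limits *)

Section Dual.
Context {R : realType} {X : normedModType R}.
Implicit Types (f g : X -> R^o) (C : set X) (x y u : X).

Section DualElement.
Variables (f : X -> R^o) (df : dual f).

Lemma dualD x y : f (x + y) = f x + f y :> R. Proof. exact: blD. Qed.
Lemma dualB x y : f (x - y) = f x - f y :> R. Proof. exact: blB. Qed.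
Lemma dualN x : f (- x) = - f x :> R. Proof. exact: blN. Qed.
Lemma dualZ (a : R) x : f (a *: x) = a * f x :> R. Proof. exact: blZ. Qed.
Lemma dual0 : f 0 = 0 :> R. Proof. exact: bl0. Qed.
Lemma dual_sum (I : Type) (r : seq I) (P : pred I) (v : I -> X) :
  f (\sum_(i <- r | P i) v i) = \sum_(i <- r | P i) (f (v i) : R) :> R.
Proof. exact: bl_sum. Qed.

End DualElement.

Definition convex C : Prop := forall s t x y, 0 <= s -> 0 <= t -> s + t = 1 ->
  C x -> C y -> C (s *: x + t *: y).

(* f comes from the sublinear functional inf_(t >= 0, c in C) (|v + t (u - c)| - t d),
   which is bounded by the norm and is at most - d at every c - u. *)
Lemma separation C u (d : R) : C !=set0 -> convex C ->
  (forall c, C c -> d <= `|u - c|) ->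
  exists2 f, dual f & (forall c, C c -> f c + d <= f u :> R) /\
    forall x, `|f x : R| <= `|x|.
Proof.
move=> [c0 Cc0] convC dC.
pose E v := [set r | exists t c, [/\ 0 <= t, C c & r = `|v + t *: (u - c)| - t * d]].
have Einf v : has_inf (E v).
  split; first by exists (`|v + 0 *: (u - c0)| - 0 * d), 0, c0; split.
  exists (- `|v|) => _ [t [c [t0 Cc ->]]].
  have : t * d <= `|t *: (u - c)| by rewrite normrZ ger0_norm// ler_wpM2l// dC.
  have := ler_normB (v + t *: (u - c)) v.
  by rewrite addrC addKr; lra.
have subE : sublinear (fun v => inf (E v)).
  split.
    apply: inf_homogeneous => //.
      move=> s v _ s0 [t [c [t0 Cc ->]]]; exists (s * t), c; split=> //.
        by rewrite mulr_ge0// ltW.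
      by rewrite -scalerA -scalerDr normrZ gtr0_norm//; ring.
    apply/eqP; rewrite eq_le; apply/andP; split.
      apply: ge_inf; first exact: (Einf 0).2.
      by exists 0, c0; split; rewrite // scale0r addr0 normr0 mul0r subr0.
    apply: lb_le_inf; first exact: (Einf 0).1.
    move=> _ [t [c [t0 Cc ->]]]; rewrite add0r normrZ ger0_norm// -mulrBr.
    by rewrite mulr_ge0// subr_ge0 dC.
  apply: inf_subadditive => // v w _ _ [s [a [s0 Ca ->]]] [t [b [t0 Cb ->]]].
  have [st0|st0] := eqVneq (s + t) 0.
    have [s00 t00] : s = 0 /\ t = 0 by lra.
    exists `|v + w|; first by exists 0, c0; split; rewrite // scale0r addr0 mul0r subr0.
    by rewrite s00 t00 !scale0r !addr0 !mul0r !subr0 ler_normD.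
  have stp : 0 < s + t by rewrite lt0r st0 addr_ge0.
  (* With these weights [s (u - a) + t (u - b) = (s + t) (u - c)], so the two terms merge into one
     of the same shape. *)
  pose c := (s / (s + t)) *: a + (t / (s + t)) *: b.
  have Cc : C c.
    apply: convC => //; try by rewrite divr_ge0// ltW.
    by rewrite -mulrDl divff.
  exists (`|v + w + (s + t) *: (u - c)| - (s + t) * d).
    by exists (s + t), c; split; rewrite ?addr_ge0.
  have -> : (s + t) *: (u - c) = s *: (u - a) + t *: (u - b).
    rewrite /c !scalerBr scalerDr !scalerA !(mulrC (s + t)) !divfK//.
    by rewrite scalerDl opprD addrACA.
  rewrite addrACA.
  by have := ler_normD (v + s *: (u - a)) (w + t *: (u - b)); lra.
have [f [lf fE]] := sublinear_dominates subE.
have fn x : f x <= `|x|.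
  apply: le_trans (fE x) _; apply: ge_inf; first exact: (Einf x).2.
  by exists 0, c0; split; rewrite // scale0r addr0 mul0r subr0.
have [F FE] := linear_mixed lf.
have fb x : `|f x : R| <= `|x|.
  have := fn (- x); rewrite normrN; have := fn x.
  by rewrite FE raddfN ler_norml /=; lra.
have df : dual f by apply/bounded_linearP; split=> //; exists 1 => // x; rewrite mul1r.
exists f => //; split=> // c Cc.
have : f (c - u) <= - d.
  apply: le_trans (fE _) _; apply: ge_inf; first exact: (Einf _).2.
  exists 1, c; split=> //.
  by rewrite scale1r -(opprB u c) addNr normr0 sub0r mul1r.
by rewrite dualB//; lra.
Qed.

(** The functional comes from separating [x] from the origin at distance [|x|]. *)
Lemma dual_neq0 x : x != 0 -> exists2 f, dual f & f x != 0.
Proof.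
move=> x0; have [||c ->|f df [fx _]] := @separation [set 0] x `|x|.
- by exists 0.
- by move=> s t _ _ _ _ _ -> ->; rewrite !scaler0 addr0.
- by rewrite subr0.
exists f => //; apply: lt0r_neq0; have := fx 0 erefl.
by rewrite dual0// add0r; apply: lt_le_trans; rewrite normr_gt0.
Qed.

Lemma convex_ball u (r : R) : convex [set x | `|x - u| <= r].
Proof.
move=> s t x y s0 t0 st /= xr yr.
have -> : s *: x + t *: y - u = s *: (x - u) + t *: (y - u).
  by rewrite !scalerBr addrACA -opprD -scalerDl st scale1r.
apply: le_trans (ler_normD _ _) _; rewrite !normrZ !ger0_norm//.
have : s * `|x - u| <= s * r by rewrite ler_wpM2l.
have : t * `|y - u| <= t * r by rewrite ler_wpM2l.
have : s * r + t * r = r by rewrite -mulrDl st mul1r.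
lra.
Qed.

Lemma closed_ball_norm u (r : R) : closed [set x | `|x - u| <= r].
Proof.
apply/closure_id; apply/seteqP; split; first exact: subset_closure.
move=> x /closure_normP xr /=; apply/ler_addgt0Pr => e e0.
have [c /= cu xc] := xr _ e0.
rewrite -(subrK c x) -addrA; apply: le_trans (ler_normD _ _) _.
by rewrite (addrC r) lerD.
Qed.

Section WeakLimit.
Context {T : Type} (F : set_system T).
Implicit Types v : T -> X.

(** Weak convergence along an arbitrary filter. In a reflexive space, bounded families converge
    along ultrafilters, so no subsequences are extracted. *)
Definition weak_limit v x : Prop :=
  forall f, dual f -> (f (v t) : R) @[t --> F] --> (f x : R).

(** Mazur's theorem: if [x] were at distance at least [e] from [C], a functional would separate them
    with gap [e], and this gap would survive the limit. *)
Lemma weak_limit_closed {FF : ProperFilter F} v x C :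
  closed C -> convex C -> F (v @^-1` C) -> weak_limit v x -> C x.
Proof.
move=> clC convC FC vx; have [t /= Cvt] := filter_ex FC.
suff : closure C x by rewrite -(closure_id _).1.
apply/closure_normP => e e0; apply: contrapT => nC.
have [c Cc|f df [fx _]] := @separation C x e (ex_intro _ _ Cvt) convC.
  by rewrite leNgt; apply/negP => /ltW ?; apply: nC; exists c.
suff : f x <= f x - e by lra.
rewrite -(cvg_lim (@Rhausdorff R) (vx f df)).
apply: limr_le; first by apply/cvg_ex; exists (f x); exact: vx.
rewrite (cvg_lim (@Rhausdorff R) (vx f df)).
by apply: filterS FC => s /fx; lra.
Qed.

(** Compactness of [[-M, M]] gives a cluster point, and a cluster point of an ultrafilter is a
    limit. *)
Lemma ultra_cvg_bounded {UF : UltraFilter F} (v : T -> R) (M : R) :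
  F [set t | `|v t| <= M] -> exists l : R, v t @[t --> F] --> l.
Proof.
move=> FM.
have FM' : F (v @^-1` [set` `[- M, M]]).
  by apply: filterS FM => t vM; rewrite /= in_itv/= -ler_norml.
have [l [_ cl]] := @segment_compact R _ _ (v @ F) _ FM'.
exists l => B nB; have [//|FC] := in_ultra_setVsetC (v @^-1` B) UF.
by have [y []] := cl (~` B) B FC nB.
Qed.

(** The limits of [f (v t)] define an element of the bidual, bounded by [M], which reflexivity
    represents by a vector. *)
Lemma weak_compact {UF : UltraFilter F} v (M : R) : reflexive_space X ->
  F [set t | `|v t| <= M] -> exists x, weak_limit v x.
Proof.
move=> reflX FM.
have cvgf f : dual f -> cvg ((f (v t) : R) @[t --> F]).
  move=> df; have [N N0 Nb] := bl_bound df.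
  have [|l fl] := @ultra_cvg_bounded UF (f \o v) (N * M).
    by apply: filterS FM => t /= vM; apply: le_trans (Nb _) _; rewrite ler_wpM2l.
  by apply/cvg_ex; exists l.
pose phi f : R := lim ((f (v t) : R) @[t --> F]).
have [|x phix] := reflX phi.
  split.
    move=> a f g df dg; apply: cvg_lim; first exact: Rhausdorff.
    apply: (@cvgD _ R^o); last exact: cvgf.
    by apply: (@cvgZl_tmp _ R^o); exact: cvgf.
  exists M => f df.
  have bM : \forall t \near F, `|f (v t) : R| <= M * opnorm f.
    apply: filterS FM => t /= vM; apply: le_trans (le_opnorm _ df) _.
    rewrite mulrC ler_wpM2r//; exact: opnorm_ge0.
  rewrite ler_norml; apply/andP; split.
    by apply: limr_ge; [exact: cvgf|apply: filterS bM => t; rewrite ler_norml => /andP[]].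
  by apply: limr_le; [exact: cvgf|apply: filterS bM => t; rewrite ler_norml => /andP[]].
by exists x => f df; rewrite -phix//; exact: cvgf.
Qed.

End WeakLimit.
End Dual.

(** * Nearest points and support points *)

Section SupportPoint.
Context {R : realType} {X : normedModType R} (reflX : reflexive_space X).
Variables (C : set X) (clC : closed C) (convC : convex C).

(** A minimizing sequence is bounded, so it has a weak limit along an ultrafilter. The limit stays
    in [C] and in every closed ball about [u] of radius larger than the distance, as these sets are
    closed and convex. *)
Lemma nearest_point u : C !=set0 ->
  exists2 z, C z & forall c, C c -> `|u - z| <= `|u - c|.
Proof.
move=> [c0 Cc0]; pose D := [set `|u - c| | c in C].
have infD : has_inf D.
  split; first by exists `|u - c0|, c0.
  by exists 0 => _ [c _ <-].
have /choice [v vP] n : exists c, C c /\ `|u - c| < inf D + n.+1%:R^-1.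
  have n0 : 0 < n.+1%:R^-1 :> R by rewrite invr_gt0.
  by have [_ [c Cc <-] ?] := inf_adherent n0 infD; exists c.
have [G [UG oG]] := @ultraFilterLemma _ \oo _.
have [|z vz] := @weak_compact _ _ _ _ UG v (`|u| + (inf D + 1)) reflX.
  apply: oG; near=> n => /=.
  have -> : v n = u - (u - v n) by rewrite opprB addrC subrK.
  apply: le_trans (ler_normB _ _) _; rewrite lerD2l.
  apply/ltW/(lt_le_trans (vP n).2); rewrite lerD2l invf_le1//.
  by rewrite ler1n.
exists z; first by apply: (weak_limit_closed clC) vz => //; apply: filterE => n; exact: (vP n).1.
move=> c Cc; apply: (@le_trans _ _ (inf D)); last first.
  by apply: ge_inf; [exact: infD.2|exists c].
apply/ler_addgt0Pr => e e0; rewrite distrC.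
apply: (weak_limit_closed (@closed_ball_norm _ _ u (inf D + e)) (@convex_ball _ _ u _)) vz.
apply: oG; near=> n => /=; rewrite distrC; apply/ltW/(lt_le_trans (vP n).2).
rewrite lerD2l; apply: ltW; near: n; exact: near_infty_natSinv_lt (PosNum e0).
Unshelve. all: by end_near. Qed.

(** [b] is the last point of the segment from [p] to [q] in [C], and [u] lies just beyond it. As the
    line misses 0, [u] can be taken closer to [b] than to 0; then 0 is not the point of [C] nearest
    to [u]. *)
Lemma segment_exit p q : C p -> ~ C q -> (forall t : R, p + t *: (q - p) != 0) ->
  exists b u, [/\ C b, ~ C u & `|u - b| < `|u|].
Proof.
move=> Cp nCq pq0; pose w t := p + t *: (q - p).
have wB s t : w s - w t = (s - t) *: (q - p).
  by rewrite /w opprD addrACA subrr add0r scalerBl.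
pose E := [set t : R | 0 <= t <= 1 /\ C (w t)].
have E0 : E 0 by rewrite /E /= lexx ler01 /w scale0r addr0.
have supE : has_sup E.
  by split; [exists 0|exists 1 => t [/andP[]]].
pose s := sup E; pose K := `|q - p| + 1.
have K0 : 0 < K by rewrite ltr_wpDl.
have s0 : 0 <= s by apply: ub_le_sup E0; exact: supE.2.
have s1 : s <= 1 by apply: ge_sup; [exact: supE.1|move=> t [/andP[]]].
have wK t t' : `|w t - w t'| <= `|t - t'| * K.
  by rewrite wB normrZ ler_wpM2l// lerDl.
have Cs : C (w s).
  suff : closure C (w s) by rewrite -(closure_id _).1.
  apply/closure_normP => e e0.
  have eK : 0 < e / K by rewrite divr_gt0.
  have [t Et st] := sup_adherent eK supE.
  exists (w t); first exact: Et.2.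
  apply: le_trans (wK _ _) _; rewrite -ler_pdivlMr//.
  have ts : t <= s by apply: ub_le_sup Et; exact: supE.2.
  by rewrite ger0_norm ?subr_ge0//; move: st; rewrite -/s; lra.
have s1' : s < 1.
  rewrite lt_neqAle s1 andbT; apply/eqP => s1e; apply: nCq.
  by move: Cs; rewrite s1e /w scale1r addrC subrK.
have ws0 : 0 < `|w s| by rewrite normr_gt0 pq0.
(* An advance by [r] moves the point by at most a third of [|w s|], so that [|w t|] remains at least
   two thirds of it. *)
pose r := `|w s| / (3 * K).
have r0 : 0 < r by rewrite divr_gt0// mulr_gt0.
pose t := Num.min 1 (s + r).
have st : s < t by rewrite lt_min s1'/=; lra.
have tr : t <= s + r by rewrite ge_min lexx orbT.
have t1 : t <= 1 by rewrite ge_min lexx.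
exists (w s), (w t); split=> //.
  move=> Ct; have : t <= s.
    apply: ub_le_sup; first exact: supE.2.
    by split=> //; rewrite t1 andbT; lra.
  lra.
have tsw : `|w t - w s| <= `|w s| / 3.
  apply: le_trans (wK _ _) _; rewrite gtr0_norm ?subr_gt0//.
  have -> : `|w s| / 3 = r * K by rewrite /r; field; rewrite gt_eqF.
  by rewrite ler_wpM2r ?(ltW K0)//; lra.
have := ler_normB (w t) (w t - w s); rewrite opprB addrC subrK => h.
lra.
Qed.

(** The support point is the point of [C] nearest to some [u] outside [C] that is closer to [C] than
    to 0. The vector [v] helps to leave [C] along a line that misses 0. *)
Lemma support_point x : (exists v, forall a : R, v <> a *: x) ->
  C 0 -> C x -> x != 0 -> C <> setT ->
  exists z (f : X -> R^o), [/\ C z, z != 0, dual f, (exists v, f v != 0) &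
    forall c, C c -> f c <= f z].
Proof.
move=> [v vx] C0 Cx x0 CT.
have indep p q : p != 0 -> (forall a : R, q <> a *: p) ->
    forall t : R, p + t *: (q - p) != 0.
  move=> p0 qp t; apply/eqP => e.
  have [t0|t0] := eqVneq t 0; first by move: e; rewrite t0 scale0r addr0; apply/eqP.
  apply: (qp (t^-1 * (t - 1))); apply: (scalerI t0).
  rewrite scalerA mulrA divff// mul1r scalerBl scale1r.
  by apply/eqP; rewrite -subr_eq0 -e scalerBr opprB addrCA; apply/eqP.
have [b [u [Cb nCu ub]]] : exists b u, [/\ C b, ~ C u & `|u - b| < `|u|].
  have [q nCq] : exists q, ~ C q.
    apply: contrapT => nq; apply: CT; apply/seteqP; split=> // q _.
    by apply: contrapT => Cq; apply: nq; exists q.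
  (* If [q] is a multiple of [x], the line through them may meet 0. Go instead from [x] to [v] if
     [v] is outside [C], and from [v] to [q] otherwise. *)
  have [[a qa]|qx] := pselect (exists a : R, q = a *: x); last first.
    apply: (segment_exit Cx nCq); apply: indep => // a qa.
    by apply: qx; exists a.
  have [Cv|nCv] := pselect (C v); last first.
    by apply: (segment_exit Cx nCv); apply: indep.
  have q0 : q != 0 by apply/eqP => q0; apply: nCq; rewrite q0.
  apply: (segment_exit Cv nCq); apply: indep => [|c qv].
    by apply/eqP => v0; apply: (vx 0); rewrite scale0r.
  have c0 : c != 0 by apply: contra_neq q0 => c0; rewrite qv c0 scale0r.
  by apply: (vx (c^-1 * a)); rewrite -scalerA -qa qv scalerK.
have [z Cz zmin] := nearest_point u (ex_intro _ _ Cb).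
have uz : 0 < `|u - z|.
  by rewrite normr_gt0 subr_eq0; apply/eqP => uz; apply: nCu; rewrite uz.
(* Since [f] is bounded by the norm, [f u - f z <= |u - z|], while [f c + |u - z| <= f u] on [C];
   hence [f] is maximal at [z]. *)
have [f df [fC fn]] := separation (ex_intro _ _ Cb) convC zmin.
exists z, f; split=> //.
- apply: contraTneq ub => z0; rewrite -leNgt.
  by have := zmin _ Cb; rewrite z0 subr0.
- exists (u - z); rewrite dualB//; apply: lt0r_neq0.
  by have := fC z Cz; lra.
- move=> c /fC; have := fn (u - z); rewrite (dualB df) ler_norml => /andP[_].
  lra.
Qed.

End SupportPoint.

(** * Covering the image of the unit ball by finitely many balls *)

Section BallCover.
Context {R : realType} {X : normedModType R}.
Implicit Types (S T : X -> X) (c d : R) (n m : nat).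

(** A measure of noncompactness that also records the number of balls, for the pigeonhole argument
    of [small_combination]. *)
Definition ball_cover n T c : Prop := exists (I : finType) (k : I -> X),
  (#|I| <= n)%N /\ forall x, `|x| <= 1 -> exists i, `|T x - k i| <= c.

Lemma ball_cover_le n T c d : c <= d -> ball_cover n T c -> ball_cover n T d.
Proof.
move=> cd [I [k [In kT]]]; exists I, k; split=> // x /kT[i ki].
by exists i; exact: le_trans ki cd.
Qed.

Lemma ball_cover_leq n m T c :
  (n <= m)%N -> ball_cover n T c -> ball_cover m T c.
Proof.
by move=> nm [I [k [In kT]]]; exists I, k; split=> //; exact: leq_trans In nm.
Qed.

Lemma norm_le_scale (x : X) c : `|x| <= c -> exists2 y, `|y| <= 1 & x = c *: y.
Proof.
move=> xc; have [c0|c0] := eqVneq c 0.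
  exists 0; first by rewrite normr0.
  by move: xc; rewrite c0 scale0r normr_le0 => /eqP.
have cp : 0 < c by rewrite lt0r c0 (le_trans _ xc).
exists (c^-1 *: x); last by rewrite scalerA divff// scale1r.
by rewrite normrZ gtr0_norm ?invr_gt0// ler_pdivrMl// mulr1.
Qed.

Lemma ball_cover_norm T c : 0 <= c -> (forall x, `|T x| <= c * `|x|) -> ball_cover 1 T c.
Proof.
move=> c0 Tc; exists unit, (fun=> 0); split; first by rewrite card_unit.
move=> x x1; exists tt; rewrite subr0; apply: le_trans (Tc x) _.
by rewrite -[leRHS]mulr1 ler_wpM2l.
Qed.

(** [S] maps a ball of radius [d] to a translate of [d] times the image of the unit ball; hence
    numbers and radii multiply. *)
Lemma ball_cover_comp n m S T c d : bounded_linear S -> 0 <= d ->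
  ball_cover n S c -> ball_cover m T d -> ball_cover (n * m) (S \o T) (c * d).
Proof.
move=> bS d0 [I [k [In kS]]] [J [l [Jm lT]]].
exists (I * J)%type, (fun p => S (l p.2) + d *: k p.1); split.
  by rewrite card_prod leq_mul.
move=> x /lT[j /norm_le_scale[y y1 Txy]]; have [i ki] := kS y y1.
exists (i, j) => /=; rewrite opprD addrA -(blB bS) Txy (blZ bS) -scalerBr.
by rewrite normrZ ger0_norm// mulrC ler_wpM2r.
Qed.

Lemma ball_coverD n m S T c d :
  ball_cover n S c -> ball_cover m T d -> ball_cover (n * m) (S + T) (c + d).
Proof.
move=> [I [k [In kS]]] [J [l [Jm lT]]].
exists (I * J)%type, (fun p => k p.1 + l p.2); split.
  by rewrite card_prod leq_mul.
move=> x x1; have [i ki] := kS x x1; have [j lj] := lT x x1.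
exists (i, j) => /=; rewrite fctDE opprD addrACA.
by apply: le_trans (ler_normD _ _) _; exact: lerD.
Qed.

Lemma ball_coverZ n T c (a : R) : ball_cover n T c -> ball_cover n (a *: T) (`|a| * c).
Proof.
move=> [I [k [In kT]]]; exists I, (fun i => a *: k i); split=> // x /kT[i ki].
by exists i; rewrite fctZE -scalerBr normrZ ler_wpM2l.
Qed.

Lemma compact_ball_cover K (e : R) : compact_operators K -> 0 < e ->
  exists n, ball_cover n K e.
Proof.
move=> [bK]; rewrite precompactE compact_cover => cK e0.
have [|x Kx|D _ DK] := cK X setT (fun k => ball k e).
- by move=> k _; exact: ball_open.
- by exists x => //; exact: ballxx.
pose I : finType := seq_sub (finmap.enum_fset D).
exists #|I|, I, (fun k => val k); split=> // x x1.
have [k kD] := DK (K x) (subset_closure (ex_intro2 _ _ x x1 erefl)).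
rewrite -ball_normE /= => /ltW Kxk.
by exists (SeqSub kD); rewrite distrC.
Qed.

Lemma compact_operators0 : compact_operators (0 : X -> X).
Proof.
split; first exact: bounded_linear_cst0.
rewrite (_ : _ @` _ = [set 0]).
  rewrite precompact_closed; first exact: compact_set1.
  exact: accessible_closed_set1 (hausdorff_accessible (@norm_hausdorff _ X)) _.
apply/seteqP; split=> [_ [x _ <-]//|_ ->].
by exists 0; rewrite /= ?normr0.
Qed.

(** The slack [d e] is split in three: one third for the term [h e], one for a compact [K] that
    nearly attains the essential norm, and one for the radius of the balls covering the image of
    [K]. *)
Lemma essentially_real_ball_cover T (d : R) : essentially_real T -> 0 < d ->
  exists2 e : R, 0 < e &
    exists n, ball_cover n (idfun - e *: (T \o T)) (1 + d * e).
Proof.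
move=> [bT [h ho hT]] d0.
have d3 : 0 < d / 3 by rewrite divr_gt0.
have hd : \forall e \near 0^'+, `|h e| <= d / 3 * `|e|.
  by have /eqoP := ho; apply.
have [e [e0 [he Te]]] : exists e : R, 0 < e /\ `|h e| <= d / 3 * `|e| /\
    essential_norm (idfun - e *: (T \o T)) <= 1 + h e.
  near (0 : R)^'+ => e; exists e; split; [|split].
  - by near: e; exact: nbhs_right_gt.
  - by near: e.
  - by near: e.
exists e => //; set S := idfun - _ in Te *.
have {he} he : h e <= d / 3 * e.
  by apply: le_trans (ler_norm _) _; rewrite -(gtr0_norm e0) in he *; rewrite normr_id in he.
have de : 0 < d / 3 * e by rewrite mulr_gt0.
have [||_ [K cK <-] SK] := @inf_lt R [set opnorm (S + K) | K in @compact_operators R X]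
    (1 + d / 3 * e + d / 3 * e).
- by exists (opnorm (S + 0)), 0 => //; exact: compact_operators0.
- by apply: le_lt_trans Te _; lra.
have bS : bounded_linear S.
  apply: bounded_linearD; first exact: bounded_linear_id.
  rewrite -scaleN1r; do 2 apply: bounded_linearZ.
  exact: bounded_linear_comp.
have bSK : bounded_linear (S + K) by apply: bounded_linearD => //; exact: cK.1.
have [n Kn] := compact_ball_cover cK de.
exists (1 * n)%N; have -> : S = (S + K) + (-1) *: K by rewrite scaleN1r addrK.
apply: (@ball_cover_le _ _ (1 + d / 3 * e + d / 3 * e + `|-1| * (d / 3 * e))).
  by rewrite normrN1; lra.
apply: ball_coverD; last exact: ball_coverZ.
apply: ball_cover_norm => [|x]; first lra.
by apply: le_trans (le_opnorm _ bSK) _; rewrite ler_wpM2r// ltW.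
Unshelve. all: by end_near. Qed.

End BallCover.

(** * Commutative algebras without invariant subspaces, and positive vectors *)

Section Transitive.
Context {R : realType} {X : normedModType R}.
Variables (A : set (X -> X)) (algA : operator_algebra A)
  (commA : commutative_family A)
  (transA : forall L : set X, ~ invariant_subspace A L).
Implicit Types (S T U : X -> X) (x y z : X) (f : X -> R^o).

Let boundedA T : A T -> bounded_linear T.
Proof. by case: algA => + _ _ _ _; apply. Qed.

Let addA S T : A S -> A T -> A (S + T).
Proof. by case: algA => _ _ + _ _; apply. Qed.

Let scaleA a T : A T -> A (a *: T).
Proof. by case: algA => _ _ _ + _; apply. Qed.

Let compA S T : A S -> A T -> A (S \o T).
Proof. by case: algA => _ _ _ _; apply. Qed.

Let subA S T : A S -> A T -> A (S - T).
Proof. by move=> AS AT; rewrite -scaleN1r; apply: addA => //; apply: scaleA. Qed.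

Let commuteA S T x : A S -> A T -> S (T x) = T (S x).
Proof. by move=> AS AT; have /(congr1 (@^~ x)) := commA AS AT. Qed.

Definition unitization : set (X -> X) :=
  [set S | exists a T, A T /\ S = a *: idfun + T].

Local Notation B := unitization.

Lemma unitization_alg T : A T -> B T.
Proof. by move=> AT; exists 0, T; rewrite scale0r add0r. Qed.

Lemma unitization_id : B idfun.
Proof. by exists 1, 0; split; [case: algA|rewrite scale1r addr0]. Qed.

Lemma unitizationD S T : B S -> B T -> B (S + T).
Proof.
move=> [a [S' [AS ->]]] [b [T' [AT ->]]]; exists (a + b), (S' + T').
by split; [exact: addA|rewrite addrACA scalerDl].
Qed.

Lemma unitizationZ a S : B S -> B (a *: S).
Proof.
move=> [b [S' [AS ->]]]; exists (a * b), (a *: S').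
by split; [exact: scaleA|rewrite scalerDr scalerA].
Qed.

Lemma unitization_sum (I : finType) (c : I -> R) (S : I -> X -> X) :
  (forall i, B (S i)) -> B (\sum_i c i *: S i).
Proof.
move=> BS; elim/big_ind: _ => [|S' T'|i _]; last exact: unitizationZ.
- by apply: unitization_alg; case: algA.
- exact: unitizationD.
Qed.

Lemma unitization_comp_alg S T : B S -> A T -> A (S \o T).
Proof.
move=> [a [S' [AS ->]]] AT.
suff -> : (a *: idfun + S') \o T = a *: T + (S' \o T).
  by apply: addA; [exact: scaleA|exact: compA].
by [].
Qed.

Lemma unitization_comp S T : B S -> B T -> B (S \o T).
Proof.
move=> BS [b [T' [AT ->]]].
have bS : bounded_linear S.
  have [a [S' [AS ->]]] := BS.
  by apply: bounded_linearD; [exact/bounded_linearZ/bounded_linear_id|exact: boundedA].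
suff -> : S \o (b *: idfun + T') = b *: S + (S \o T').
  apply: unitizationD; first exact: unitizationZ.
  exact/unitization_alg/unitization_comp_alg.
by apply/funext => x /=; rewrite !fctDE !fctZE /= (blD bS) (blZ bS).
Qed.

Lemma unitization_bounded S : B S -> bounded_linear S.
Proof.
move=> [a [S' [AS ->]]]; apply: bounded_linearD; last exact: boundedA.
exact/bounded_linearZ/bounded_linear_id.
Qed.

Lemma unitization_comm S T x : B S -> B T -> S (T x) = T (S x).
Proof.
move=> [a [S' [AS ->]]] [b [T' [AT ->]]].
rewrite !fctDE !fctZE /= (blD (boundedA AS)) (blD (boundedA AT)).
rewrite (blZ (boundedA AS)) (blZ (boundedA AT)) (commuteA x AS AT).
by rewrite !scalerDr !scalerA (mulrC a b) -!addrA; congr (_ + _); rewrite addrCA.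
Qed.

Lemma transitive_setT (L : set X) x : linear_subspace L -> closed L ->
  (forall T, A T -> T @` L `<=` L) -> L x -> x != 0 -> L = setT.
Proof.
move=> linL clL AL Lx x0; apply: contrapT => LT; apply: (transA (L := L)).
by split=> // L0; move: Lx x0; rewrite L0 /= => ->; rewrite eqxx.
Qed.

(** The closed orbit is a closed subspace stable under [A], and the unit of [B] puts [x] into it. *)
Lemma orbit_dense x z : x != 0 -> closure [set S x | S in B] z.
Proof.
move=> x0; set L := closure _; suff -> : L = setT by [].
have Lx : L x by apply: subset_closure; exists idfun => //; exact: unitization_id.
apply: (transitive_setT _ _ _ Lx) => //; last 1 first.
- move=> T AT; apply: closure_stable (boundedA AT) _ => _ [_ [S BS <-] <-].
  by exists (T \o S) => //; exact: unitization_comp (unitization_alg AT) BS.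
- split; first by apply: subset_closure; exists 0 => //; apply: unitization_alg; case: algA.
  move=> a y w Ly Lw; rewrite -(scale1r w); apply: closure_combination => //.
  move=> _ _ [S BS <-] [T BT <-]; rewrite scale1r.
  by exists (a *: S + T) => //; apply: unitizationD => //; exact: unitizationZ.
- exact: closed_closure.
Qed.

(** The kernel of an operator commuting with [A] is closed and stable under [A]. *)
Lemma commutant_injective S x : bounded_linear S ->
  (forall T y, A T -> S (T y) = T (S y)) -> x != 0 -> S x = 0 ->
  forall y, S y = 0.
Proof.
move=> bS ST x0 Sx y.
suff kerT : [set y | S y = 0] = setT by have : setT y by []; rewrite -kerT.
apply: (transitive_setT _ _ _ Sx) => //.
- split=> [|a u v /= Su Sv]; first exact: bl0.
  by rewrite /= (blD bS) (blZ bS) Su Sv scaler0 addr0.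
- exact: closed_ker.
- by move=> T AT _ [u Su <-]; rewrite /= ST// Su (bl0 (boundedA AT)).
Qed.

Lemma unitization_injective S x : B S -> x != 0 -> S x = 0 -> S = 0.
Proof.
move=> BS x0 Sx; apply/funext => y.
apply: (commutant_injective (unitization_bounded BS) _ x0 Sx) => T u AT.
exact: unitization_comm BS (unitization_alg AT).
Qed.

Lemma dual_orbit_eq0 f x : dual f -> x != 0 ->
  (forall S, B S -> f (S x) = 0) -> forall y, f y = 0.
Proof.
move=> df x0 fS y; have [M M0 Mf] := bl_bound_gt0 df.
apply/eqP; rewrite -normr_le0; apply/ler_addgt0Pr => e e0; rewrite add0r.
have /closure_normP/(_ _ (divr_gt0 e0 M0)) := @orbit_dense x y x0.
move=> [_ [S BS <-] yS].
rewrite -(subrK (S x) y) (blD df) (fS S BS) addr0; apply: le_trans (Mf _) _.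
by rewrite mulrC -ler_pdivlMr.
Qed.

Variables (T0 : X -> X) (AT0 : A T0) (T0_neq0 : T0 <> 0).

(** Polarizing with [S \o T0] and [T0] gives [f (S (T0 (T0 x))) = 0] for all [S] in [B]. As [T0] is
    injective, [T0 (T0 x)] is nonzero and has a dense orbit. *)
Lemma dual_squares_eq0 f x : dual f -> x != 0 ->
  (forall S, A S -> f (S (S x)) = 0) -> forall y, f y = 0.
Proof.
move=> df x0 fS.
have inj z : z != 0 -> T0 z != 0.
  move=> z0; apply/eqP => T0z; apply: T0_neq0.
  exact: unitization_injective (unitization_alg AT0) z0 T0z.
apply: (dual_orbit_eq0 df (inj _ (inj _ x0))) => S BS.
have AU : A (S \o T0) := unitization_comp_alg BS AT0.
set U := S \o T0 in AU.
have := fS _ (addA AU AT0); rewrite !fctDE (blD (boundedA AU)) (blD (boundedA AT0)).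
rewrite !(dualD df) (fS U AU) (fS T0 AT0) -(commuteA x AU AT0) add0r addr0.
by rewrite /U /=; lra.
Qed.

Section Positive.
Variables (f : X -> R^o) (df : dual f).

Definition positive_vector z : Prop := forall S, A S -> 0 <= (f (S (S z)) : R).

Lemma positive_vector_sqr S z :
  A S -> positive_vector z -> positive_vector (S (S z)).
Proof.
move=> AS Pz T AT; have := Pz (T \o S) (compA AT AS).
by rewrite /= !(commuteA _ AT AS).
Qed.

(** This is [S^n T]; the factor [T] keeps it in [A] for [n = 0], as [A] may lack the identity. *)
Let power S T n : X -> X := iter n (fun U => S \o U) T.

(* The numbers f (S^2n T^2 z) form a bounded convex sequence, hence they
   decrease. *)
Lemma positive_vector_contraction S z : A S -> (forall x, `|S x| <= `|x|) ->
  positive_vector z -> positive_vector (z - S (S z)).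
Proof.
move=> AS S1 Pz T AT.
pose U n := power S T n; pose a n : R := f (U n (U n z)).
have AU n : A (U n) by elim: n => //= n IH; exact: compA.
have US n x : U n.+1 x = S (U n x) by [].
have SU n x : U n (S x) = S (U n x) by exact: commuteA.
(* The second difference of [a] is [f] applied to the square of [U n - U n.+2] at [z], because [U n]
   times [U n.+2] is the square of [U n.+1]. *)
have aconv n : a n.+1 - a n <= a n.+2 - a n.+1.
  have := Pz _ (subA (AU n) (AU n.+2)).
  have -> : (U n - U n.+2) ((U n - U n.+2) z) =
      (U n (U n z) - U n (U n.+2 z)) - (U n.+2 (U n z) - U n.+2 (U n.+2 z)).
    by rewrite -!(blB (boundedA (AU _))).
  rewrite !(dualB df).
  have -> : U n (U n.+2 z) = U n.+1 (U n.+1 z) by rewrite !US SU.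
  have -> : U n.+2 (U n z) = U n.+1 (U n.+1 z) by rewrite !US SU.
  rewrite /a; lra.
have [M M0 MT] := bl_bound (boundedA AT); have [N N0 Nf] := bl_bound df.
have Ux n x : `|U n x| <= `|T x|.
  by elim: n => //= n IH; apply: le_trans (S1 _) IH.
have abound n : a n <= N * (M * (M * `|z|)).
  apply: le_trans (ler_norm _) _; apply: le_trans (Nf _) _; rewrite ler_wpM2l//.
  apply: le_trans (Ux _ _) _; apply: le_trans (MT _) _; rewrite ler_wpM2l//.
  exact: le_trans (Ux _ _) (MT _).
have a10 : a 1 <= a 0.
  rewrite leNgt; apply/negP => a01.
  have astep n : a 1 - a 0 <= a n.+1 - a n.
    by elim: n => // n IH; apply: le_trans IH (aconv n).
  have amono n : a 0 + n%:R * (a 1 - a 0) <= a n.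
    by elim: n => [|n IH]; [lra|have := astep n; rewrite -natr1; lra].
  have d0 : 0 < a 1 - a 0 by rewrite subr_gt0.
  set c := N * (M * (M * `|z|)) in abound.
  have r0 : 0 <= (c - a 0) / (a 1 - a 0).
    by rewrite divr_ge0// ?(ltW d0)// subr_ge0.
  have := archi_boundP r0; set n := Num.bound _; rewrite ltr_pdivrMr// => cn.
  have h1 := abound n; have h2 := amono n; lra.
rewrite (blB (boundedA AT)) (blB (boundedA AT)) dualB// subr_ge0.
suff -> : T (T (S (S z))) = U 1 (U 1 z) by [].
by rewrite /U /= !(commuteA _ AT AS).
Qed.

Lemma positive_functional_absurd x : reflexive_space X ->
  (forall x, exists v, forall a : R, v <> a *: x) ->
  x != 0 -> positive_vector x -> (exists v, f v != 0) -> False.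
Proof.
move=> reflX dimX x0 Px [v fv].
have P0 : positive_vector 0.
  by move=> S AS; rewrite !(bl0 (boundedA AS)) (dual0 df).
have convP : convex positive_vector.
  move=> s t y z s0 t0 _ Py Pz S AS.
  rewrite !(blD (boundedA AS)) !(blZ (boundedA AS)) (dualD df) !(dualZ df).
  by rewrite addr_ge0// mulr_ge0// ?Py ?Pz.
(* Were [- x] positive too, [f] would vanish on all squares at [x], hence everywhere. *)
have PT : positive_vector <> setT.
  move=> PT; move/eqP: fv; apply; apply: (dual_squares_eq0 df x0) => S AS.
  have : positive_vector (- x) by rewrite PT.
  move=> /(_ S AS); rewrite !(blN (boundedA AS)) (dualN df).
  by have := Px S AS; lra.
have clP : closed positive_vector.
  apply/closure_id; apply/seteqP; split; first exact: subset_closure.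
  move=> y /closure_normP Py S AS.
  have bS := boundedA AS.
  have [M M0 Mf] := bl_bound_gt0 (bounded_linear_comp df (bounded_linear_comp bS bS)).
  rewrite -oppr_le0; apply/ler_addgt0Pr => e e0; rewrite add0r.
  have [z Pz yz] := Py (e / M) (divr_gt0 e0 M0).
  have fyz : `|f (S (S y)) - f (S (S z)) : R| <= e.
    rewrite -(dualB df) -!(blB bS); apply: le_trans (Mf _) _.
    by rewrite mulrC -ler_pdivlMr.
  by have := Pz S AS; move: fyz; rewrite ler_norml => /andP[]; lra.
have [z [g [Pz z0 dg [w gw] gmax]]] :=
  support_point reflX clP convP (dimX x) P0 Px x0 PT.
move/eqP: gw; apply; apply: (dual_squares_eq0 dg z0) => S AS.
(* The positive vectors form a cone: comparing [z] with 0 and with [2 z] gives the two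
   inequalities. *)
have gz : g z = 0 :> R.
  have := gmax _ P0; rewrite (dual0 dg) => gz0.
  have P2z : positive_vector (2 *: z).
    by move=> T AT; rewrite !(blZ (boundedA AT)) (dualZ df) mulr_ge0// Pz.
  by have := gmax _ P2z; rewrite (dualZ dg); lra.
have [M M0 MS] := bl_bound_gt0 (boundedA AS).
(* After scaling [S] to a contraction, both [S^2 z] and [z - S^2 z] are positive vectors, which
   bounds [g (S^2 z)] by 0 from above and from below. *)
have AMS : A (M^-1 *: S) by exact: scaleA.
have MS1 y : `|(M^-1 *: S) y| <= `|y|.
  by rewrite fctZE normrZ gtr0_norm ?invr_gt0// ler_pdivrMl.
have h1 := gmax _ (positive_vector_contraction AMS MS1 Pz).
have h2 := gmax _ (positive_vector_sqr AMS Pz).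
move: h1 h2; rewrite (dualB dg) gz.
have -> : (M^-1 *: S) ((M^-1 *: S) z) = (M^-1 * M^-1) *: S (S z).
  by rewrite !fctZE (blZ (boundedA AS)) scalerA.
rewrite (dualZ dg) => h1 h2.
have : M^-1 * M^-1 * g (S (S z)) == 0 by rewrite eq_le; apply/andP; split; lra.
by rewrite !mulf_eq0 invr_eq0 (gt_eqF M0) /= => /eqP.
Qed.

End Positive.

End Transitive.

(** * Orbits of the semigroup of essential contractions *)

Section EssentialContractions.
Context {R : realType} {X : normedModType R} (reflX : reflexive_space X).
Variables (A : set (X -> X)) (algA : operator_algebra A)
  (commA : commutative_family A)
  (transA : forall L : set X, ~ invariant_subspace A L).
Implicit Types (S T W : X -> X) (x y z : X) (f : X -> R^o).

Local Notation B := (unitization A).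

Let boundedB T : B T -> bounded_linear T.
Proof. exact: unitization_bounded. Qed.

Definition essential_contraction : set (X -> X) :=
  [set T | B T /\ exists n, ball_cover n T 1].

Local Notation G := essential_contraction.

(** The closed orbit is stable under [G], so at its support point [z] the value of [f] cannot
    increase under an element of [G], in particular under a rescaled [1 - e S^2]. *)
Lemma orbit_support x : (forall y, exists v, forall a : R, v <> a *: y) ->
  (forall T, A T -> essentially_real T) ->
  x != 0 -> closure [set T x | T in G] <> setT ->
  exists z f, [/\ z != 0, dual f, (exists v, f v != 0) & positive_vector A f z].
Proof.
move=> dimX realA x0; set O := [set T x | T in G] => OT.
have Gid : G idfun.
  split; first exact: unitization_id.
  exists 1%N; by apply: ball_cover_norm => // y; rewrite mul1r.
have G0 : G 0.
  split; first by apply: unitization_alg; case: algA.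
  exists 1%N; by apply: ball_cover_norm => // y; rewrite normr0 mul1r.
have convO : convex (closure O).
  move=> s t y z s0 t0 st; apply: closure_combination.
  move=> _ _ [S [BS [n Sn]] <-] [T [BT [m Tm]] <-].
  exists (s *: S + t *: T) => //; split.
    by apply: unitizationD => //; exact: unitizationZ.
  exists (n * m)%N; have := ball_coverD (ball_coverZ s Sn) (ball_coverZ t Tm).
  by rewrite !ger0_norm// !mulr1 st.
have O0 : closure O 0 by apply: subset_closure; exists 0.
have Ox : closure O x by apply: subset_closure; exists idfun.
have [z [f [Oz z0 df f0 fmax]]] :=
  support_point reflX (@closed_closure _ O) convO (dimX x) O0 Ox x0 OT.
exists z, f; split=> // S AS.
have fz0 : 0 <= f z :> R by have := fmax _ O0; rewrite (dual0 df).
rewrite -oppr_le0; apply/ler_addgt0Pr => d d0; rewrite add0r.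
(* The tolerance [d' = d / (f z + 1)] makes the final bound [d' * f z] at most [d]; the summand 1
   covers the case [f z = 0]. *)
have fz1 : 0 < (f z : R) + 1 by rewrite ltr_wpDl.
have dd0 : 0 < d / ((f z : R) + 1) by rewrite divr_gt0.
set d' := d / _ in dd0.
have [e e0 [n]] := essentially_real_ball_cover (realA _ AS) dd0.
set T := idfun - _ => Tn.
have de : 0 < 1 + d' * e by rewrite ltr_wpDr// mulr_ge0// ltW.
have GT : G ((1 + d' * e)^-1 *: T).
  split.
    apply: unitizationZ => //; apply: unitizationD => //; first exact: unitization_id.
    rewrite -scaleN1r; apply: unitizationZ => //; apply: unitizationZ => //.
    by apply: unitization_alg; case: algA => _ _ _ _; apply.
  exists n; have := ball_coverZ (1 + d' * e)^-1 Tn.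
  by rewrite gtr0_norm ?invr_gt0// mulVf// gt_eqF.
have /fmax : closure O (((1 + d' * e)^-1 *: T) z).
  have [BT [m Tm]] := GT.
  apply: (closure_stable (boundedB BT) (C := O)); last by exists z.
  move=> _ [_ [U [BU [k Uk]] <-] <-]; exists (((1 + d' * e)^-1 *: T) \o U) => //.
  split; first exact: unitization_comp.
  exists (m * k)%N; have := ball_cover_comp (boundedB BT) ler01 Tm Uk.
  by rewrite mulr1.
rewrite fctZE (dualZ df) -ler_pdivlMl ?invr_gt0// invrK.
have -> : T z = z - e *: S (S z) by [].
rewrite (dualB df) (dualZ df) => h.
have {}h : - f (S (S z)) <= d' * f z.
  by rewrite -(ler_pM2l e0); lra.
apply: le_trans h _; rewrite /d' mulrAC ler_pdivrMr//.
by rewrite ler_wpM2l ?(ltW d0)//; lra.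
Qed.

End EssentialContractions.

(** * Returning operators and linear dependence in the unitization *)

Section Hilden.
Context {R : realType}.

Lemma ultra_exists {T : Type} (F : set_system T) {UF : UltraFilter F}
    (I : finType) (P : I -> set T) :
  F [set t | exists i, P i t] -> exists i, F (P i).
Proof.
move=> FP; apply: contrapT => nF.
have FC : F [set t | forall i, ~ P i t].
  apply: filter_forall => i; have [Fi|//] := in_ultra_setVsetC (P i) UF.
  by exfalso; apply: nF; exists i.
by have [t [[i Pit] /(_ i)]] := filter_ex (filterI FP FC).
Qed.

Context {X : normedModType R}.
Implicit Types (S T W : X -> X) (x y z : X) (f : X -> R^o).

(* The integer combinations of d vectors with coefficients in {0, ..., 2^n}
   outnumber the M^n balls that cover W(unit ball). *)
Lemma small_combination d M n W (v : 'I_d -> X) (C : R) :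
    bounded_linear W -> ball_cover (M ^ n) W (4^-1 ^+ n) ->
    (0 < d)%N -> (M <= 2 ^ d)%N -> 0 < C -> \sum_i `|v i| <= C ->
  exists c : 'I_d -> R, [/\ forall i, `|c i| <= 1, exists i, `|c i| = 1 &
    `|\sum_i c i *: W (v i)| <= 2 * C / 2 ^+ n].
Proof.
move=> bW [I [k [IM kW]]] d0 Md C0 vC.
pose N := (2 ^ n)%N.
have N0 : 0 < N%:R :> R by rewrite ltr0n expn_gt0.
pose w (a : {ffun 'I_d -> 'I_N.+1}) : X := \sum_i (a i)%:R *: v i.
have wC a : `|w a| <= N%:R * C.
  apply: le_trans (ler_norm_sum _ _ _) _.
  apply: (@le_trans _ _ (\sum_i N%:R * `|v i|)); last by rewrite -mulr_sumr ler_wpM2l// ltW.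
  apply: ler_sum => i _; rewrite normrZ ler_wpM2r// ger0_norm// ler_nat.
  by rewrite -ltnS.
have NC : 0 < N%:R * C by rewrite mulr_gt0.
have /choice[h hP] a : exists i, `|W ((N%:R * C)^-1 *: w a) - k i| <= 4^-1 ^+ n.
  by apply: kW; rewrite normrZ gtr0_norm ?invr_gt0// ler_pdivrMl// mulr1.
(* The [(2^n + 1)^d] coefficient vectors outnumber [(2^n)^d = (2^d)^n >= M^n]. *)
have [a [b [ab hab]]] : exists a b, a != b /\ h a = h b.
  apply: contrapT => nab; suff /leq_card : injective h.
    rewrite card_ffun !card_ord => le1; have := leq_trans le1 IM.
    apply/negP; rewrite -ltnNge.
    apply: (@leq_ltn_trans (N ^ d)%N); last by rewrite ltn_exp2r.
    by rewrite /N -expnM mulnC expnM; case: (n) => // n'; rewrite leq_exp2r.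
  move=> a b hab; apply/eqP; apply: contrapT => /negP ab.
  by apply: nab; exists a, b.
(* Two points in one ball of radius [4^-n], scaled back by [2^n C]. *)
have Wab : `|W (w a - w b)| <= 2 * C / 2 ^+ n.
  have E : W (w a - w b) = (N%:R * C) *: (W ((N%:R * C)^-1 *: w a) - W ((N%:R * C)^-1 *: w b)).
    by rewrite -(blB bW) -scalerBr (blZ bW) scalerA divff ?gt_eqF// scale1r.
  rewrite E normrZ gtr0_norm//.
  have : `|W ((N%:R * C)^-1 *: w a) - W ((N%:R * C)^-1 *: w b)| <= 2 * 4^-1 ^+ n.
    rewrite -(subrK (k (h a)) (W _)) -addrA.
    apply: le_trans (ler_normD _ _) _.
    rewrite (_ : 2 * 4^-1 ^+ n = 4^-1 ^+ n + 4^-1 ^+ n); last by ring.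
    by rewrite lerD// distrC hab.
  move=> le4; apply: (@le_trans _ _ (N%:R * C * (2 * 4^-1 ^+ n))).
    by rewrite ler_wpM2l// ltW.
  rewrite /N natrX (_ : 4^-1 = 2^-1 * 2^-1 :> R); last by field.
  rewrite exprMn exprVn.
  have t0 : 2 ^+ n != 0 :> R by rewrite expf_neq0.
  suff -> : 2 ^+ n * C * (2 * ((2 ^+ n)^-1 * (2 ^+ n)^-1)) = 2 * C / 2 ^+ n :> R by [].
  by field.
(* These differences are integers, not all zero, so the largest has modulus at least 1 and dividing
   by it does not increase the norm. *)
pose e i : R := (a i)%:R - (b i)%:R.
have [m ema] : exists m, forall i, `|e i| <= `|e m|.
  have [m _ mP] := @arg_maxP _ _ _ (Ordinal d0) xpredT (fun i => `|e i|) erefl.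
  by exists m => i; exact: mP.
have em1 : 1 <= `|e m|.
  have [i abi] : exists i, a i != b i.
    apply: contrapT => nab; move/eqP: ab; apply; apply/ffunP => i.
    by apply/eqP; apply: contrapT => /negP abi; apply: nab; exists i.
  apply: le_trans (ema i); rewrite /e.
  have : (a i : nat) != b i by apply: contra_neq abi => /val_inj.
  rewrite neq_ltn => /orP[lt|lt].
    rewrite distrC ger0_norm ?subr_ge0 ?ler_nat ?(ltnW lt)//.
    by rewrite lerBrDr addrC natr1 ler_nat.
  rewrite ger0_norm ?subr_ge0 ?ler_nat ?(ltnW lt)//.
  by rewrite lerBrDr addrC natr1 ler_nat.
have em0 : 0 < `|e m| by exact: lt_le_trans em1.
exists (fun i => e i / `|e m|); split.
- by move=> i; rewrite normrM normfV normr_id ler_pdivrMr// mul1r.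
- by exists m; rewrite normrM normfV normr_id divff// gt_eqF.
have -> : \sum_i (e i / `|e m|) *: W (v i) = `|e m|^-1 *: W (w a - w b).
  rewrite /w -sumrB (bl_sum bW) scaler_sumr; apply: eq_bigr => i _.
  by rewrite -scalerBl (blZ bW) scalerA mulrC.
rewrite normrZ normfV normr_id ler_pdivrMl//; apply: le_trans Wab _.
have : 0 <= 2 * C / 2 ^+ n by rewrite divr_ge0 ?mulr_ge0 ?(ltW C0)// exprn_ge0.
by move=> h0; rewrite -[leLHS]mul1r ler_wpM2r.
Qed.

Variables (reflX : reflexive_space X) (A : set (X -> X)) (algA : operator_algebra A)
  (commA : commutative_family A)
  (transA : forall L : set X, ~ invariant_subspace A L).

Local Notation B := (unitization A).
Local Notation G := (essential_contraction A).

Variable (denseG : forall x, x != 0 -> closure [set T x | T in G] = setT).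

Let boundedB T : B T -> bounded_linear T.
Proof. exact: unitization_bounded. Qed.

(** Otherwise the points of the ball that no operator of a finite list returns generate a proper
    filter. The weak limit [x] along a finer ultrafilter lies in the ball, so it is nonzero and some
    [T] brings it near [x0]. As [T] has a finite cover by small balls, it also returns some of the
    points that should escape it. *)
Lemma finite_return x0 : `|x0| = 2 -> exists ts : seq (X -> X),
  (forall T, T \in ts -> B T /\ exists n, ball_cover n T 4^-1) /\
  forall y, `|y - x0| <= 1 -> exists2 T, T \in ts & `|T y - x0| <= 1.
Proof.
move=> x02; apply: contrapT => nts.
pose good (ts : seq (X -> X)) :=
  forall T, T \in ts -> B T /\ exists n, ball_cover n T 4^-1.
pose stay (ts : seq (X -> X)) :=
  [set y | `|y - x0| <= 1 /\ forall T, T \in ts -> ~ `|T y - x0| <= 1].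
have proper_stay : ProperFilter (filter_from good stay).
  apply: filter_from_proper.
    apply: filter_from_filter; first by exists [::].
    move=> s t gs gt; exists (s ++ t).
      by move=> T; rewrite mem_cat => /orP[/gs|/gt].
    move=> y [y1 yst]; split; split=> // T Tst; apply: yst;
      by rewrite mem_cat Tst ?orbT.
  move=> ts gts; apply: contrapT => ts0; apply: nts; exists ts; split=> // y y1.
  apply: contrapT => nT; apply: ts0; exists y; split=> // T Tts Ty.
  by apply: nT; exists T.
have [U [UU sU]] := ultraFilterLemma proper_stay.
have U1 : U [set y | `|y - x0| <= 1].
  by apply: sU; exists [::] => // y [].
have [|x Ux] := @weak_compact _ _ _ U UU idfun 3 reflX.
  apply: filterS U1 => y /= y1; rewrite -(subrK x0 y).
  by apply: le_trans (ler_normD _ _) _; rewrite x02; lra.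
have x1 : `|x - x0| <= 1.
  exact: weak_limit_closed (@closed_ball_norm _ _ x0 1) (@convex_ball _ _ x0 1) U1 Ux.
have xn0 : x != 0.
  apply/eqP => x0'; move: x1; rewrite x0' sub0r normrN x02; lra.
(* Approximating [4 x0] within 2 and dividing by 4 leaves an error of [1/2] and a covering radius of
   [1/4]. *)
have : closure [set T x | T in G] (4 *: x0) by rewrite denseG.
move=> /closure_normP /(_ 2 (ltr0Sn _ 1))[_ [T' [BT' [n T'n]] <-] T'x].
pose T := 4^-1 *: T'.
have BT : B T by exact: unitizationZ.
have bT := boundedB BT.
have Tn : ball_cover n T 4^-1.
  by have := ball_coverZ 4^-1 T'n; rewrite mulr1 ger0_norm.
have Tx : `|T x - x0| <= 2^-1.
  have -> : T x - x0 = 4^-1 *: (T' x - 4 *: x0).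
    by rewrite scalerBr scalerA mulVf// scale1r.
  rewrite normrZ distrC ger0_norm//; lra.
have [I [k [_ kT]]] := Tn.
(* One ball of the cover contains [T y] for [U]-almost all [y], and hence the weak limit [T x]; so
   [T y] is within [1/2] of [T x]. *)
have [|i Ui] := @ultra_exists _ U UU I (fun i => [set y | `|T y - (T x0 + k i)| <= 4^-1]).
  apply: filterS U1 => y /= /kT[i ki]; exists i => /=.
  by rewrite opprD addrA -(blB bT).
have Tki : `|T x - (T x0 + k i)| <= 4^-1.
  apply: (weak_limit_closed (@closed_ball_norm _ _ _ _) (@convex_ball _ _ _ _) Ui).
  by move=> f df; apply: (Ux (f \o T)); exact: bounded_linear_comp.
have UT : U (stay [:: T]).
  by apply: sU; exists [:: T] => // S; rewrite inE => /eqP ->; split=> //; exists n.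
have [y [/= [_ /(_ T)] nT Tyk]] := filter_ex (filterI UT Ui).
apply: nT; first by rewrite inE.
have -> : T y - x0 = (T y - (T x0 + k i)) - (T x - (T x0 + k i)) + (T x - x0).
  by rewrite opprB (addrA (T y - _)) subrK addrA subrK.
apply: le_trans (ler_normD _ _) _; apply: le_trans (lerD (ler_normB _ _) Tx) _.
lra.
Qed.

Lemma uniform_ball_cover (ts : seq (X -> X)) (c : R) :
  (forall T, T \in ts -> exists n, ball_cover n T c) ->
  exists n, forall T, T \in ts -> ball_cover n T c.
Proof.
elim: ts => [_|T ts IH tsc]; first by exists 0%N.
have [|n nts] := IH; first by move=> S Sts; apply: tsc; rewrite inE Sts orbT.
have [m mT] := tsc T (mem_head _ _).
exists (maxn m n) => S; rewrite inE => /orP[/eqP ->|/nts].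
  by apply: ball_cover_leq mT; exact: leq_maxl.
by apply: ball_cover_leq; exact: leq_maxr.
Qed.

Lemma return_orbit x0 : `|x0| = 2 -> exists (M : nat) (W : nat -> X -> X),
  forall n, [/\ B (W n), ball_cover (M ^ n) (W n) (4^-1 ^+ n) &
    `|W n x0 - x0| <= 1].
Proof.
move=> x02; have [ts [tsB tsret]] := finite_return x02.
have [M Mts] := @uniform_ball_cover ts 4^-1 (fun T Tts => (tsB T Tts).2).
(* [next y] is the operator that returns [y]; outside the ball it takes the default value
   [idfun]. *)
have /choice[next nextP] y : exists T, `|y - x0| <= 1 -> T \in ts /\ `|T y - x0| <= 1.
  have [/tsret[T Tts Ty]|ny] := pselect (`|y - x0| <= 1); first by exists T.
  by exists idfun.
pose W := fix W n := if n is m.+1 then next (W m x0) \o W m else idfun.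
exists M, W; elim=> [|n [BW Wc W1]] /=.
  split; [exact: unitization_id| |by rewrite subrr normr0].
  by rewrite expn0 expr0; apply: ball_cover_norm => // x; rewrite mul1r.
have [nts n1] := nextP _ W1; have [BT _] := tsB _ nts; split=> //.
  exact: unitization_comp.
rewrite expnS exprS; apply: ball_cover_comp (Mts _ nts) Wc; first exact: boundedB.
by rewrite exprn_ge0.
Qed.

(** For a linear subspace [D] this says that its dimension is less than [d]. *)
Definition dependent_families (D : set (X -> X)) (d : nat) : Prop :=
  forall S : 'I_d -> X -> X, (forall i, D (S i)) ->
    exists c : 'I_d -> R, (exists i, c i != 0) /\ \sum_i c i *: S i = 0.

Lemma unitization_dependent (x1 : X) : x1 != 0 ->
  exists d, dependent_families B d.
Proof.
move=> x1n0; pose x0 := (2 / `|x1|) *: x1.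
have x02 : `|x0| = 2.
  by rewrite normrZ normrM normfV normr_id divfK ?normr_eq0// ger0_norm.
have [M [W WP]] := return_orbit x02.
have Wx1 n : `|W n x0 - x0| <= 1 by have [] := WP n.
(* [M.+1] is positive and satisfies [M <= 2 ^ M.+1], as [small_combination] requires. *)
exists M.+1 => S BS; have bS i := boundedB (BS i).
pose C := \sum_i `|S i x0| + 1.
have C0 : 0 < C by rewrite ltr_wpDl// sumr_ge0.
have /choice[c cP] n : exists c : 'I_M.+1 -> R, [/\ forall i, `|c i| <= 1,
    exists i, `|c i| = 1 & `|\sum_i c i *: S i (W n x0)| <= 2 * C / 2 ^+ n].
  have [BW Wc _] := WP n.
  have [||||c [c1 c2 cW]] := @small_combination M.+1 M n (W n) (fun i => S i x0) C (boundedB BW) Wc.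
  - by [].
  - by rewrite (leq_trans (ltnW (ltn_expl M (ltnSn 1))))// leq_exp2l.
  - exact: C0.
  - by rewrite lerDl.
  exists c; split=> //; congr (_ <= _): cW; congr `| _ |; apply: eq_bigr => i _.
  by rewrite (unitization_comm algA commA _ BW (BS i)).
have [V [UV oV]] := @ultraFilterLemma _ \oo _.
have /choice[b bP] i : exists l : R, c n i @[n --> V] --> l.
  apply: (@ultra_cvg_bounded _ _ V UV _ 1); apply: filterE => n.
  by have [c1 _ _] := cP n; exact: c1.
(* A single index carries a coefficient of modulus 1 for [V]-almost all [n], so the limit
   coefficients do not all vanish. *)
have [m Vm] : exists m, V [set n | `|c n m| = 1].
  by apply: ultra_exists; apply: filterE => n; have [_ c1 _] := cP n; exact: c1.
have bm : `|b m| = 1.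
  have : `|c n m| @[n --> V] --> `|b m| by exact: cvg_norm.
  move=> /(cvg_lim (@Rhausdorff R)) <-; apply: cvg_lim; first exact: Rhausdorff.
  apply: cvg_near_cst; exact: Vm.
have [|z Vz] := @weak_compact _ _ _ V UV (fun n => W n x0) 3 reflX.
  apply: filterE => n /=; rewrite -(subrK x0 (W n x0)).
  by apply: le_trans (ler_normD _ _) _; rewrite x02; have := Wx1 n; lra.
have z1 : `|z - x0| <= 1.
  apply: weak_limit_closed (@closed_ball_norm _ _ x0 1) (@convex_ball _ _ x0 1) _ Vz.
  exact: filterE.
have zn0 : z != 0.
  by apply/eqP => z0; move: z1; rewrite z0 sub0r normrN x02; lra.
exists b; split; first by exists m; rewrite -normr_eq0 bm oner_eq0.
have BSb : B (\sum_i b i *: S i) by exact: unitization_sum.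
apply: (unitization_injective algA commA transA BSb zn0).
have sumE (e : 'I_M.+1 -> R) y : (\sum_i e i *: S i) y = \sum_i e i *: S i y.
  by rewrite fct_sumE.
apply/eqP; apply: contrapT => /negP /dual_neq0[f df]; apply/negP; rewrite negbK.
apply/eqP; rewrite sumE (dual_sum df).
(* Each summand is a convergent scalar times the value of the functional [f \o S i] along the weakly
   convergent [W n x0]. *)
have lim1 : (f (\sum_i c n i *: S i (W n x0)) : R) @[n --> V] -->
    \sum_i (f (b i *: S i z) : R).
  under eq_cvg => n do rewrite (dual_sum df).
  apply: cvg_big => [|i _]; first by move=> l; exact: add_continuous.
  rewrite (dualZ df).
  under eq_cvg => n do rewrite (dualZ df).
  apply: cvgM; first exact: bP.
  by apply: (Vz (f \o S i)); exact: bounded_linear_comp.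
have [N N0 Nf] := bl_bound df.
have lim0 : (f (\sum_i c n i *: S i (W n x0)) : R) @[n --> V] --> (0 : R).
  apply/(@cvgrPdist_le _ R^o) => e e0; pose K := N * (2 * C) + 1.
  have K0 : 0 < K by rewrite ltr_wpDl// !mulr_ge0// ltW.
  apply: oV; near=> n; rewrite sub0r normrN.
  apply: le_trans (Nf _) _; have [_ _ cn] := cP n.
  apply: (@le_trans _ _ (N * (2 * C / 2 ^+ n))); first by rewrite ler_wpM2l.
  apply: (@le_trans _ _ (K * n.+1%:R^-1)).
    rewrite mulrA ler_pM// ?invr_ge0 ?exprn_ge0 ?mulr_ge0 ?(ltW C0)//.
      by rewrite lerDl.
    by rewrite lef_pV2 ?posrE ?exprn_gt0// -natrX ler_nat ltn_expl.
  rewrite mulrC -ler_pdivlMr//; apply/ltW.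
  by near: n; exact: near_infty_natSinv_lt (PosNum (divr_gt0 e0 K0)).
by rewrite -(cvg_lim (@Rhausdorff R) lim1) (cvg_lim (@Rhausdorff R) lim0).
Unshelve. all: by end_near. Qed.

End Hilden.

(** * Real matrices and complex eigenvalues *)

Lemma real_matrix_invariant_pair (R : rcfType) n (M : 'M[R]_n) : (0 < n)%N ->
  exists a b (u v : 'rV[R]_n), [/\ u != 0 \/ v != 0,
    u *m M = a *: u - b *: v & v *m M = b *: u + a *: v].
Proof.
move=> n0; have [l /eigenvalueP[w wM w0]] :=
  @eigenvalue_closed (complex R) n (map_mx (real_complex R) M) n0.
have ReD (x y : complex R) : complex.Re (x + y) = complex.Re x + complex.Re y.
  by case: x; case: y.
have ImD (x y : complex R) : complex.Im (x + y) = complex.Im x + complex.Im y.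
  by case: x; case: y.
(* With [l = a + i b] and [w = u + i v], the two identities are the real and imaginary parts of
   [w M = l w]. *)
case: l wM => a b wM.
pose u : 'rV[R]_n := map_mx (@complex.Re R) w.
pose v : 'rV[R]_n := map_mx (@complex.Im R) w.
have ReM (x : complex R) (y : R) : complex.Re (x * real_complex R y) = complex.Re x * y.
  by case: x => r s /=; rewrite mulr0 subr0.
have ImM (x : complex R) (y : R) : complex.Im (x * real_complex R y) = complex.Im x * y.
  by case: x => r s /=; rewrite mulr0 add0r.
exists a, b, u, v; split.
- have [u0|] := eqVneq u 0; last by left.
  right; apply: contra_neq w0 => v0; apply/rowP => j.
  move/rowP/(_ j): u0; move/rowP/(_ j): v0; rewrite !mxE.
  by case: (w 0 j) => r s /= -> ->.
- apply/rowP => j; move/rowP/(_ j): wM; rewrite !mxE => /(congr1 (@complex.Re R)).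
  rewrite (big_morph _ ReD (erefl : complex.Re 0 = 0)).
  under eq_bigr do rewrite mxE ReM.
  under [X in _ -> X = _]eq_bigr do rewrite mxE.
  by move=> ->; case: (w 0 j).
- apply/rowP => j; move/rowP/(_ j): wM; rewrite !mxE => /(congr1 (@complex.Im R)).
  rewrite (big_morph _ ImD (erefl : complex.Im 0 = 0)).
  under eq_bigr do rewrite mxE ImM.
  under [X in _ -> X = _]eq_bigr do rewrite mxE.
  by move=> ->; case: (w 0 j) => r s /=; rewrite addrC.
Qed.

(** * Unitizations of dimension at most two *)

Section FiniteDimensional.
Context {R : realType} {X : normedModType R}.
Variables (A : set (X -> X)) (algA : operator_algebra A)
  (commA : commutative_family A)
  (transA : forall L : set X, ~ invariant_subspace A L).
Implicit Types (S T P : X -> X) (x y z : X) (f : X -> R^o).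

Local Notation B := (unitization A).

Let boundedB T : B T -> bounded_linear T.
Proof. exact: unitization_bounded. Qed.

Let commuteB S T x : B S -> B T -> S (T x) = T (S x).
Proof. exact: unitization_comm. Qed.

(** Two linear conditions on three independent vectors leave a nonzero [z] with [f z = f (J z) = 0].
    The common kernel of [f] and [f \o J] is then a nontrivial subspace, stable under [B] because 1
    and [J] span [B]. *)
Lemma two_generated_absurd J : dim_at_least 3 X -> B J ->
  (forall S, B S -> exists a b : R, S = a *: idfun + b *: J) -> False.
Proof.
move=> [e eI] BJ BE; have bJ := boundedB BJ.
have e0 : e 0 != 0.
  apply/eqP => e0; have := eI (fun i => (i == 0)%:R) _ 0.
  rewrite big_ord_recl eqxx scale1r e0 add0r big1 => [|i _]; last by rewrite scale0r.
  by move=> /(_ erefl)/eqP; rewrite oner_eq0.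
have [f df fe] := dual_neq0 e0.
have dfJ : dual (f \o J) by exact: bounded_linear_comp.
pose M : 'M[R]_(3, 2) := \matrix_(i, j) (if j == 0 then f (e i) else f (J (e i))).
have : kermx M != 0.
  rewrite kermx_eq0 /row_free; apply/eqP => rM.
  by have := rank_leq_col M; rewrite rM.
move=> /rowV0Pn[c /sub_kermxP cM c0].
pose z := \sum_i c 0 i *: e i.
have z0 : z != 0.
  apply/eqP => z0; move/eqP: c0; apply; apply/rowP => i; rewrite mxE.
  exact: (eI (fun i => c 0 i)).
pose L := [set x | f x = 0] `&` [set x | (f \o J) x = 0].
have Lz : L z.
  split.
    apply: etrans (bl_sum df _ _ _) _.
    move/rowP/(_ 0): cM; rewrite !mxE => h; apply: etrans h; apply: eq_bigr => i _.
    by rewrite (blZ df) mxE.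
  apply: etrans (bl_sum dfJ _ _ _) _.
  move/rowP/(_ 1): cM; rewrite !mxE => h; apply: etrans h; apply: eq_bigr => i _.
  by rewrite (blZ dfJ) mxE.
have LT : L = setT.
  apply: (transitive_setT transA _ _ _ Lz) => //.
  - split; first by split; [exact: (bl0 df)|exact: (bl0 dfJ)].
    move=> a x y [/= fx fJx] [/= fy fJy].
    by split; rewrite /= ?(blD bJ) ?(blZ bJ) (blD df) (blZ df) ?fx ?fy ?fJx ?fJy scaler0 addr0.
  - by apply: closedI; exact: closed_ker.
  - move=> T AT _ [x [/= fx fJx] <-].
    have fJ S : B S -> f (S x) = 0.
      move=> /BE[a [b ->]]; rewrite fctDE !fctZE (blD df) !(blZ df) fx.
      by rewrite [f (J x)]fJx !scaler0 addr0.
    split; first exact: fJ (unitization_alg AT).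
    exact: fJ (unitization_comp algA BJ (unitization_alg AT)).
by move/eqP: fe; apply; have [] : L (e 0) by rewrite LT.
Qed.

Lemma unitization_mul_eq0 S T : B S -> B T -> (forall x, S (T x) = 0) ->
  S = 0 \/ T = 0.
Proof.
move=> BS BT ST; have [->|T0] := pselect (T = 0); [by right|left].
have [x Tx] : exists x, T x != 0.
  apply: contrapT => nT; apply: T0; apply/funext => x.
  by apply/eqP; apply: contrapT => /negP Tx; apply: nT; exists x.
exact: unitization_injective BS Tx (ST x).
Qed.

Variable (quadB : forall S, B S -> exists (c e : R) P,
  [/\ B P, S = c *: idfun + P & forall x, P (P x) = - (e ^+ 2 *: x)]).

(** If some element is not scalar, its part [P] rescales to [J] with [J^2 = -1]. For any other
    element with part [Q], [Q^2 = - e^2] makes the product of [Q - e J] and [Q + e J] zero, so [Q]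
    is a multiple of [J] and two generators suffice. *)
Lemma quadratic_absurd : dim_at_least 3 X -> False.
Proof.
move=> dimX.
have Bid : B idfun by exact: unitization_id.
have [allscal|] := pselect (forall S, B S -> exists a : R, S = a *: idfun).
  apply: (two_generated_absurd dimX Bid) => S /allscal[a ->].
  by exists a, 0; rewrite scale0r addr0.
move=> /existsNP[S /not_implyP[BS nS]].
have [a [b [P [BP SE PP]]]] := quadB BS.
have b0 : b != 0.
  apply/eqP => b0; apply: nS; exists a.
  have [|P0|P0] := @unitization_mul_eq0 P P BP BP; try by rewrite SE P0 addr0.
  by move=> x; rewrite PP b0 expr0n/= scale0r oppr0.
pose J := b^-1 *: P.
have BJ : B J by exact: unitizationZ.
have bP := boundedB BP.
have JJ x : J (J x) = - x.
  rewrite /J !fctZE (blZ bP) scalerA PP scalerN scalerA -expr2 -exprMn mulVf//.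
  by rewrite expr1n scale1r.
apply: (two_generated_absurd dimX BJ) => T BT.
have [c [e [Q [BQ TE QQ]]]] := quadB BT.
have bJ := boundedB BJ; have bQ := boundedB BQ.
have BZ d : B (Q + d *: J) by apply: unitizationD => //; exact: unitizationZ.
have [x|Q0|Q0] := @unitization_mul_eq0 (Q + (- e) *: J) (Q + e *: J) (BZ _) (BZ _).
- rewrite !fctDE !fctZE (blD bQ) (blZ bQ) (blD bJ) (blZ bJ) QQ JJ.
  rewrite (commuteB x BQ BJ) scalerN scaleNr scalerDr scalerN scalerA -expr2.
  by rewrite opprD opprK addrA addrK addNr.
- by exists c, e; rewrite TE; congr (_ + _); apply/eqP; rewrite -subr_eq0 -scaleNr Q0.
- exists c, (- e); rewrite TE; congr (_ + _); apply/eqP.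
  by rewrite -subr_eq0 scaleNr opprK Q0.
Qed.

End FiniteDimensional.

(** * Bases and quadratic equations in a finite-dimensional unitization *)

Section DependentAlgebra.
Context {R : realType} {X : normedModType R}.
Variables (A : set (X -> X)) (algA : operator_algebra A)
  (commA : commutative_family A)
  (transA : forall L : set X, ~ invariant_subspace A L).
Implicit Types (S T P : X -> X).

Local Notation B := (unitization A).

Let boundedB T : B T -> bounded_linear T.
Proof. exact: unitization_bounded. Qed.

(** The least [d] with all families dependent is not 0, since the empty family is independent. An
    independent family of size [d - 1] then spans, because adjoining any [T] makes it dependent. *)
Lemma unitization_basis d : dependent_families B d -> exists n (S : 'I_n -> X -> X),
  [/\ forall i, B (S i), forall c : 'I_n -> R, \sum_i c i *: S i = 0 -> forall i, c i = 0 &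
    forall T, B T -> exists c : 'I_n -> R, T = \sum_i c i *: S i].
Proof.
move=> dd; have exd : exists n, `[< dependent_families B n >] by exists d; exact/asboolP.
case: (ex_minnP exd) => -[/asboolP d0 _|n /asboolP dn nmin].
  have [|c [[[]]]//] := d0 (fun=> idfun).
  by move=> i; exact: unitization_id.
have [S BS SI] : exists2 S : 'I_n -> X -> X, forall i, B (S i) &
    forall c : 'I_n -> R, \sum_i c i *: S i = 0 -> forall i, c i = 0.
  apply: contrapT => nS; suff /asboolP/nmin : dependent_families B n by rewrite ltnn.
  move=> S BS; apply: contrapT => nc; apply: nS; exists S => // c cS i.
  apply/eqP; apply: contrapT => /negP ci; apply: nc; exists c; split=> //.
  by exists i.
exists n, S; split=> // T BT.
pose F i := if unlift ord0 i is Some j then S j else T.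
have [|c [[i0 ci0]]] := dn F; first by move=> i; rewrite /F; case: unlift.
rewrite big_ord_recl {1}/F unlift_none.
under eq_bigr do rewrite /F liftK.
(* The coefficient of [T] cannot vanish, by independence of the [S i]; so the relation can be solved
   for [T]. *)
have [c0|c0] := eqVneq (c ord0) 0.
  rewrite c0 scale0r add0r => /SI cl; move: ci0.
  by case: (unliftP ord0 i0) => [j ->|->]; rewrite ?cl ?c0 eqxx.
move=> /eqP; rewrite addr_eq0 => /eqP cT.
exists (fun i => - (c ord0)^-1 * c (lift ord0 i)).
rewrite -[LHS](scalerK c0) cT scalerN -scaleNr scaler_sumr.
by apply: eq_bigr => i _; rewrite scalerA.
Qed.

(** Multiplication by [T] is a real matrix in a basis of [B]. An invariant pair for a complex
    eigenvalue [a + i b] shows that [P = T - a] satisfies [P^2 = - b^2] at a nonzero vector, hence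
    everywhere, as nonzero elements of [B] are injective. *)
Lemma unitization_quadratic d (x1 : X) : dependent_families B d -> x1 != 0 ->
  forall T, B T -> exists (c e : R) P,
    [/\ B P, T = c *: idfun + P & forall x, P (P x) = - (e ^+ 2 *: x)].
Proof.
move=> /unitization_basis[n [S [BS SI SB]]] x1n0 T BT.
have bT := boundedB BT.
have n0 : (0 < n)%N.
  case: n S BS SI SB => // S _ _ SB.
  have [c /(congr1 (@^~ x1))] := SB idfun (unitization_id algA).
  by rewrite big_ord0 => x10; move: x1n0; rewrite [x1]x10 eqxx.
have /choice[m mP] i : exists c : 'I_n -> R, T \o S i = \sum_j c j *: S j.
  by apply: SB; exact: unitization_comp.
pose M : 'M[R]_n := \matrix_(i, j) m i j.
pose U (w : 'rV[R]_n) : X -> X := \sum_i w 0 i *: S i.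
have UE w x : U w x = \sum_i w 0 i *: S i x by rewrite /U fct_sumE.
have UD s t w w' x : U (s *: w + t *: w') x = s *: U w x + t *: U w' x.
  rewrite !UE !scaler_sumr -big_split; apply: eq_bigr => i _.
  by rewrite !mxE scalerDl !scalerA.
have TU w x : T (U w x) = U (w *m M) x.
  rewrite !UE (bl_sum bT).
  under eq_bigr => i _.
    rewrite (blZ bT); have /(congr1 (@^~ x)) /= -> := mP i.
    rewrite fct_sumE scaler_sumr.
    over.
  rewrite exchange_big; apply: eq_bigr => j _; rewrite mxE scaler_suml.
  by apply: eq_bigr => i _; rewrite fctZE scalerA mxE.
have [a [b [u [v [uv uM vM]]]]] := real_matrix_invariant_pair M n0.
pose P := T + (- a) *: idfun.
have BP : B P.
  by apply: unitizationD => //; apply: unitizationZ => //; exact: unitization_id.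
have bP := boundedB BP.
have PU x : P (U u x) = (- b) *: U v x.
  by rewrite /P fctDE fctZE TU uM -scaleNr UD addrAC -scalerDl subrr scale0r add0r.
have PV x : P (U v x) = b *: U u x.
  by rewrite /P fctDE fctZE TU vM UD -addrA -scalerDl subrr scale0r addr0.
have U0 w : w != 0 -> exists x, U w x != 0.
  move=> w0; apply: contrapT => nU; move/eqP: w0; apply; apply/rowP => i.
  rewrite mxE; apply: (SI (fun i => w 0 i)); apply/funext => x.
  by apply/eqP; apply: contrapT => /negP Ux; apply: nU; exists x.
have [y y0 PPy] : exists2 y, y != 0 & P (P y) = - (b ^+ 2 *: y).
  case: uv => /U0[x Ux].
    exists (U u x) => //.
    by rewrite PU (blZ bP) PV scalerA mulNr scaleNr expr2.
  exists (U v x) => //.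
  by rewrite PV (blZ bP) PU scalerA mulrN scaleNr expr2.
exists a, b, P; split=> //.
  by rewrite /P addrCA -scalerDl subrr scale0r addr0.
move=> x; pose Q := P \o P + b ^+ 2 *: idfun.
have BQ : B Q.
  apply: unitizationD => //; first exact: unitization_comp.
  by apply: unitizationZ => //; exact: unitization_id.
have Qy : Q y = 0 by rewrite /Q fctDE fctZE /= PPy addNr.
have /(congr1 (@^~ x)) := unitization_injective algA commA transA BQ y0 Qy.
by rewrite /Q fctDE fctZE /= => /eqP; rewrite addr_eq0 => /eqP.
Qed.

End DependentAlgebra.

(** * Independent vectors and the final dichotomy *)

Lemma dim_at_least3_independent (R : realType) (X : lmodType R) (x : X) :
  dim_at_least 3 X -> exists v, forall a : R, v <> a *: x.
Proof.
move=> [e eI]; apply: contrapT => nv.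
have xe i : exists a : R, e i = a *: x.
  apply: contrapT => na; apply: nv; exists (e i) => a ea; apply: na.
  by exists a.
have [a0 e0] := xe 0; have [a1 e1] := xe 1.
have rel (c0 c1 : R) : c0 * a0 + c1 * a1 = 0 -> c0 = 0 /\ c1 = 0.
  move=> c01; pose c (i : 'I_3) := if i == 0 then c0 else if i == 1 then c1 else 0.
  have cI : forall i, c i = 0.
    apply: eI; rewrite 3!big_ord_recl big_ord0 /c /=.
    have -> : lift ord0 ord0 = 1 :> 'I_3 by exact: val_inj.
    by rewrite e0 e1 !scalerA scale0r !addr0 -scalerDl c01 scale0r.
  by have := cI 0; have := cI 1.
(* The relation [a1 e_0 - a0 e_1 = 0] forces [a0 = 0], and then [e_0 = 0] is a nontrivial
   relation. *)
have [_ a00] : a1 = 0 /\ - a0 = 0 by apply: rel; ring.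
have [one0 _] : (1 : R) = 0 /\ (0 : R) = 0 by apply: rel; lra.
by move/eqP: one0; rewrite oner_eq0.
Qed.

Theorem corollary3p2 (R : realType) (X : completeNormedModType R)
  (dimX : dim_at_least 3 X)
  (reflX : reflexive_space X)
  (A : set (X -> X))
  (algA : operator_algebra A)
  (commA : commutative_family A)
  (realA : forall T, A T -> essentially_real T) :
  exists L : set X, invariant_subspace A L.
Proof.
apply: contrapT => noinv.
have transA (L : set X) : ~ invariant_subspace A L.
  by move=> invL; apply: noinv; exists L.
have indep (y : X) := dim_at_least3_independent y dimX.
have [x1 x1n0] : exists x : X, x != 0.
  by have [v v0] := indep 0; exists v; apply/eqP => v0'; apply: (v0 0); rewrite scaler0.
have Bid := unitization_id algA.
(* If [A] is zero, [B] consists of the scalars, and the two-generator case applies with [J = 1]. *)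
have [A0|] := pselect (forall T, A T -> T = 0).
  apply: (two_generated_absurd algA transA dimX Bid) => S [a [T [/A0 -> ->]]].
  by exists a, 0; rewrite scale0r.
move=> /existsNP[T0 /not_implyP[AT0 T0n0]].
have [denseG|] := pselect (forall x : X, x != 0 ->
    closure [set T x | T in essential_contraction A] = setT).
  have [d dep] := unitization_dependent reflX algA commA transA denseG x1n0.
  apply: (quadratic_absurd algA commA transA _ dimX).
  exact: (unitization_quadratic algA commA transA dep x1n0).
move=> /existsNP[x /not_implyP[x0 nd]].
have [z [f [z0 df f0 Pz]]] := orbit_support reflX algA indep realA x0 nd.
exact: (positive_functional_absurd algA commA transA AT0 T0n0 df reflX indep z0 Pz f0).
Qed.
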